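(* Consider the over-the-air consensus protocol over a time-varying graph described in the context. Suppose: (i) $\sum_{k=0}^\infty\alpha(k)=\infty$, $\sum_{k=0}^\infty\alpha^2(k)<\infty$, and $1-\alpha(k)\sum_{j\in\mathcal{V}}\bar a_{ij}(k)>0$ for all $i,k$; (ii) ($L$-connectivity) there is an integer $L>0$ such that for every $k\ge0$ the union graph $(\mathcal{V},\mathcal{E}(k)\cup\dots\cup\mathcal{E}(k+L-1))$ is connected; (iii) $\alpha(k+1)\le\alpha(k)$ for all $k\ge0$ and $\limsup_{k\to\infty}\alpha(k)/\alpha(k+1)<\infty$. Then the system achieves almost sure consensus: there exists a random variable $x^*$ with $\lim_{k\to\infty}x_i(k)=x^*$ almost surely for every $i\in\mathcal{V}$.
   Context: Agents $\mathcal{V}=\{1,\dots,N\}$ communicate over a (deterministic) time-varying undirected graph $\mathcal{G}(k)=(\mathcal{V},\mathcal{E}(k))$ without self-loops, where $(i,j)\in\mathcal{E}(k)$ iff $(j,i)\in\mathcal{E}(k)$; absence of edges models link failures, and a node that has failed at time $k$ has no edges and does not update. Let $\mathcal{N}_i(k)=\{j:(i,j)\in\mathcal{E}(k)\}$. Each agent has a deterministic initial state $x_i(0)\in[0,x_{\max}]$. Fix $\rho>0$ and $u\in\mathbb{C}$ with $|u|=1$. The following random variables are all mutually independent: for each $i,k$, $\gamma_i(k)\in\{0,1\}$ with $\mathbb{P}(\gamma_i(k)=1)=p_i\in(0,1)$; for each ordered pair $(i,j)$ and $k$, $h_{ij}(k)\sim\mathcal{CN}(0,\Lambda_{ij})$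 with $\Lambda_{ij}=\Lambda_{ji}>0$; for each $i,k$, $n_i(k)\sim\mathcal{CN}(0,\sigma_i^2)$. Let $\Gamma_{ij}(k)=\gamma_i(k)(1-\gamma_j(k))+\gamma_j(k)(1-\gamma_i(k))$. Agent $i$ receives $y_i(k)=\sum_{j\in\mathcal{N}_i(k)}\Gamma_{ij}(k)h_{ij}(k)\sqrt{\rho x_j(k)}\,u+n_i(k)$ (the model treats the states as nonnegative). Define $\bar a_{ij}(k)=\rho(p_i(1-p_j)+p_j(1-p_i))\Lambda_{ij}$ if $(i,j)\in\mathcal{E}(k)$ and $0$ otherwise. With common step sizes $\alpha(k)>0$, a non-failed agent updates $x_i(k+1)=\big(1-\alpha(k)\sum_j\bar a_{ij}(k)\big)x_i(k)+\alpha(k)(|y_i(k)|^2-\sigma_i^2)$, while an agent that has failed at time $k$ keeps $x_i(k+1)=x_i(k)$. *)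

(* Defs.v *)
From HB Require Import structures.
From mathcomp Require Import all_boot all_order all_algebra.
From mathcomp Require Import all_classical all_reals all_analysis.
Set Implicit Arguments. Unset Strict Implicit. Unset Printing Implicit Defensive.
Import Order.TTheory GRing.Theory Num.Theory.
Import numFieldNormedType.Exports.
Local Open Scope classical_set_scope.
Local Open Scope ring_scope.

Definition mutually_independent {d} {T : measurableType d} {R : realType}
  (P : probability T R) {I : eqType} (Z : I -> T -> R) : Prop :=
  forall (s : seq I) (B : I -> set R), uniq s -> (forall i, measurable (B i)) ->
  P (\bigcap_(i in [set` s]) (Z i @^-1` B i)) =
  (\big[*%E/1%E]_(i <- s) P (Z i @^-1` B i))%E.

Definition centered_gaussian {d} {T : measurableType d} {R : realType}
  (P : probability T R) (X : T -> R) (v : R) : Prop :=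
  forall B : set R, measurable B ->
  P (X @^-1` B) = if v == 0 then (\1_B (0:R))%:E else normal_prob 0 (Num.sqrt v) B.

(* A complex random variable Z = Zre + i Zim is CN(0, v) iff Zre, Zim are
   independent centered real Gaussians with variance v/2 each
   (independence is imposed through the global mutual-independence hypothesis). *)
Definition complex_gaussian_parts {d} {T : measurableType d} {R : realType}
  (P : probability T R) (Zre Zim : T -> R) (v : R) : Prop :=
  centered_gaussian P Zre (v / 2) /\ centered_gaussian P Zim (v / 2).

Definition rv_index (N : nat) : eqType :=
  (((('I_N * nat) + ('I_N * 'I_N * nat)) + ('I_N * 'I_N * nat)) + ('I_N * nat) + ('I_N * nat))%type.

Definition all_rvs {T : Type} {R : Type} (N : nat)
  (gam : 'I_N -> nat -> T -> R) (hre him : 'I_N -> 'I_N -> nat -> T -> R)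
  (nre nim : 'I_N -> nat -> T -> R) (a : rv_index N) : T -> R :=
  match a with
  | inl (inl (inl (inl (i, k)))) => gam i k
  | inl (inl (inl (inr (i, j, k)))) => hre i j k
  | inl (inl (inr (i, j, k))) => him i j k
  | inl (inr (i, k)) => nre i k
  | inr (i, k) => nim i k
  end.

Definition graph_connected (N : nat) (e : rel 'I_N) : Prop :=
  forall i j : 'I_N, connect e i j.

Definition union_graph (N : nat) (E : nat -> rel 'I_N) (k L : nat) : rel 'I_N :=
  fun i j => [exists t : 'I_L, E (k + t)%N i j].

Definition abar {R : realType} (N : nat) (E : nat -> rel 'I_N) (rho : R)
  (p : 'I_N -> R) (Lam : 'I_N -> 'I_N -> R) (k : nat) (i j : 'I_N) : R :=
  if E k i j then rho * (p i * (1 - p j) + p j * (1 - p i)) * Lam i j else 0.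

Definition Gamma {T : Type} {R : realType} (N : nat) (gam : 'I_N -> nat -> T -> R)
  (i j : 'I_N) (k : nat) (w : T) : R :=
  gam i k w * (1 - gam j k w) + gam j k w * (1 - gam i k w).

Definition y_re {T : Type} {R : realType} (N : nat) (E : nat -> rel 'I_N) (rho : R)
  (ure uim : R) (gam : 'I_N -> nat -> T -> R) (hre him : 'I_N -> 'I_N -> nat -> T -> R)
  (nre : 'I_N -> nat -> T -> R) (x : 'I_N -> T -> R) (k : nat) (i : 'I_N) (w : T) : R :=
  \sum_(j | E k i j) Gamma gam i j k w * Num.sqrt (rho * x j w)
      * (hre i j k w * ure - him i j k w * uim) + nre i k w.

Definition y_im {T : Type} {R : realType} (N : nat) (E : nat -> rel 'I_N) (rho : R)
  (ure uim : R) (gam : 'I_N -> nat -> T -> R) (hre him : 'I_N -> 'I_N -> nat -> T -> R)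
  (nim : 'I_N -> nat -> T -> R) (x : 'I_N -> T -> R) (k : nat) (i : 'I_N) (w : T) : R :=
  \sum_(j | E k i j) Gamma gam i j k w * Num.sqrt (rho * x j w)
      * (hre i j k w * uim + him i j k w * ure) + nim i k w.

Fixpoint xstate {T : Type} {R : realType} (N : nat) (E : nat -> rel 'I_N)
  (failed : nat -> pred 'I_N) (x0 : 'I_N -> R) (alpha : nat -> R) (rho : R)
  (ure uim : R) (p : 'I_N -> R) (Lam : 'I_N -> 'I_N -> R) (s2 : 'I_N -> R)
  (gam : 'I_N -> nat -> T -> R) (hre him : 'I_N -> 'I_N -> nat -> T -> R)
  (nre nim : 'I_N -> nat -> T -> R) (k : nat) : 'I_N -> T -> R :=
  match k with
  | 0 => fun i _ => x0 i
  | k'.+1 =>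
    let x := xstate E failed x0 alpha rho ure uim p Lam s2 gam hre him nre nim k' in
    fun i w =>
      if failed k' i then x i w else
      (1 - alpha k' * \sum_j abar E rho p Lam k' i j) * x i w
      + alpha k' * ((y_re E rho ure uim gam hre him nre x k' i w) ^+ 2
                    + (y_im E rho ure uim gam hre him nim x k' i w) ^+ 2 - s2 i)
  end.

(* Main.v *)
Require Import Defs.
From HB Require Import structures.
From mathcomp Require Import all_boot all_order all_algebra.
From mathcomp Require Import all_classical all_reals all_analysis.
From mathcomp Require Import measurable_realfun ring lra.
Import Order.TTheory GRing.Theory Num.Theory.
Import numFieldNormedType.Exports.
Local Open Scope classical_set_scope.
Local Open Scope ring_scope.
Set Implicit Arguments. Unset Strict Implicit. Unset Printing Implicit Defensive.

(** For [c >= 0] put [V_c(k) = |x(k) - c 1|^2]. Since [Num.sqrt] vanishes on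
    negative states, the conditional drift of [x_i] is
    [alpha sum_j a_ij (x_j^+ - x_i)]; the map [r |-> r^+] is 1-Lipschitz and fixes
    [c], so the symmetry of [a] makes the drift of [V_c] at most [- alpha res] with
    [res = sum_ij a_ij (x_i - x_j^+)^2], up to [O(alpha^2 (1 + |x|^2))]. In
    expectation this bounds [E |x(k)|^2] and gives [sum alpha res < oo] and
    [sum |x(k+1) - x(k)|^2 < oo] almost surely. The function [sqrt (1 + V_c)] is
    1-Lipschitz, so its martingale part has summable variances although only second
    moments of [x] are controlled; hence [V_c] converges almost surely. The cases
    [c = 0, 1] yield the convergence of [|x|^2] and of [sum_i x_i], hence of the
    variance of the states around their mean. As [sum alpha = oo], the residuals
    along a whole window of [L] steps are small at arbitrarily late times, and by
    connectivity the variance is then small too: its limit is 0. *)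

(** * Moments of centered Gaussians *)

(** The noise may push a state below 0, and there the mean field is not linear: the positive part
    spoils the antisymmetry of the pairwise drifts, so that [sum_i x_i] need not be a martingale,
    and its convergence has to be read off from [V_0 - V_1 = 2 * sum_i x_i - N]. The residual does
    not depend on [c]; it compares [x_i] with [x_j^+] in both orientations of an edge, which
    controls the signs as well. The received power is quadratic in the Gaussians while the
    amplitudes grow like the square root of the state. Hence second moments of the increments cost
    fourth moments of the Gaussians but only second moments of the states, and the recursion for
    [E |x|^2] closes. Conditional expectations are replaced throughout by integrals against
    functions of the variables drawn earlier, and independence enters by pulling out one fresh
    variable at a time. *)

Section normal_moments.
Context {R : realType}.
Variables (s : R) (s0 : 0 < s).
Notation mu := (@lebesgue_measure R).
Notation phi := (normal_pdf 0 s).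

Let sN0 : s != 0. Proof. by rewrite gt_eqF. Qed.

(** The change of variables holds for the Radon-Nikodym derivative of the law; it is a.e. equal to
    [phi] because both have the same integral over every measurable set. *)
Lemma ge0_integral_normal_prob f :
  (forall x, (0 <= f x)%E) -> measurable_fun [set: measurableTypeR R] f ->
  (\int[normal_prob 0 s]_x f x = \int[mu]_x (f x * (phi x)%:E))%E.
Proof.
move=> f0 mf.
rewrite -(Radon_Nikodym_SigmaFinite.change_of_variables
  (normal_prob_dominates 0 s))//.
apply: ae_eq_integral => //.
- apply: emeasurable_funM => //.
  exact: measurable_int (Radon_Nikodym_SigmaFinite.f_integrable (normal_prob_dominates 0 s)).
- by apply: emeasurable_funM => //; apply/measurable_EFinP; exact: measurable_normal_pdf.
- apply: ae_eqe_mul2l; apply: integral_ae_eq => //.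
  + exact: Radon_Nikodym_SigmaFinite.f_integrable (normal_prob_dominates 0 s).
  + by apply/measurable_EFinP; exact: measurable_normal_pdf.
  + move=> A _ mA; rewrite -Radon_Nikodym_SigmaFinite.f_integral//.
    exact: normal_prob_dominates.
Qed.

Lemma is_derive_normal_pdf (x : R) :
  is_derive x 1 phi (- (x / s ^+ 2) * phi x).
Proof.
rewrite normal_pdfE// /normal_fun.
under eq_fun do rewrite subr0.
apply: is_derive_eq; rewrite /= /GRing.scale/= subr0.
by field; rewrite sN0.
Qed.

Lemma cvg_pow_normal_pdf n : (fun k : nat => k%:R ^+ n * phi k%:R) @ \oo --> (0 : R).
Proof.
(* With [y = k^2 / (2 s^2)], the bound [y^(n+1) / (n+1)! <= exp y] gives
   [k^n * phi k <= c / k^(n+2)], and the right-hand side is at most [c / k]. *)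
pose c := normal_peak s * ((s ^+ 2 *+ 2) ^+ n.+1 * (n.+1)`!%:R).
have H (k : nat) : (0 < k)%N -> k%:R ^+ n * phi k%:R <= c * k%:R^-1.
  move=> k0.
  have kp : 0 < k%:R :> R by rewrite ltr0n.
  have s2 : 0 < s ^+ 2 *+ 2 by rewrite pmulrn_lgt0// exprn_gt0.
  set y : R := k%:R ^+ 2 / (s ^+ 2 *+ 2).
  have y0 : 0 < y by rewrite divr_gt0// exprn_gt0.
  have E : phi k%:R = normal_peak s * (expR y)^-1.
    by rewrite normal_pdfE// /normal_fun subr0 mulNr expRN.
  have y1 : y ^+ n.+1 / n.+1`!%:R <= expR y.
    by apply: le_trans (expR_ge1Dxn n (ltW y0)); rewrite lerDr.
  have y2 : (expR y)^-1 <= n.+1`!%:R / y ^+ n.+1.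
    rewrite -[leRHS]invf_div lef_pV2// posrE ?expR_gt0//.
    by rewrite divr_gt0 ?exprn_gt0// ltr0n fact_gt0.
  rewrite E /c mulrCA -!mulrA ler_pM2l ?normal_peak_gt0//.
  apply: le_trans (_ : k%:R ^+ n * (n.+1`!%:R / y ^+ n.+1) <= _).
    by rewrite ler_pM2l// exprn_gt0.
  rewrite /y expr_div_n invf_div.
  rewrite [leLHS](_ : _ = (k%:R ^+ n * k%:R ^- 2 ^+ n.+1) * ((s ^+ 2 *+ 2) ^+ n.+1 * n.+1`!%:R)); last first.
    by rewrite exprVn; ring.
  rewrite mulrC -!mulrA !ler_pM2l ?exprn_gt0 ?ltr0n ?fact_gt0//.
  rewrite exprVn -exprM mul2n -addnn exprD invfM mulrA.
  rewrite exprS [X in X * _ <= _](_ : _ = k%:R ^-1); last first.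
    by rewrite invfM mulrCA mulfV ?mulr1// gt_eqF// exprn_gt0.
  rewrite -exprS; apply: ler_piMr; first by rewrite invr_ge0 ltW.
  by rewrite invf_le1 ?exprn_gt0// exprn_ege1// ler1n.
apply: (@squeeze_cvgr _ _ _ _ (cst 0) (fun k : nat => c * k%:R^-1)).
- near=> k; rewrite H ?mulr_ge0 ?exprn_ge0 ?normal_pdf_ge0//=.
  by near: k; exists 1%N.
- exact: cvg_cst.
- rewrite -(mulr0 c); apply: cvgMr.
  apply/gtr0_cvgV0; last exact: cvgr_idn.
  by near=> k; rewrite ltr0n; near: k; exists 1%N.
Unshelve. all: by end_near. Qed.

Let continuous_powphi n : continuous (fun x : R => x ^+ n * phi x).
Proof.
by move=> x; apply: cvgM; [exact: exprn_continuous|exact: continuous_normal_pdf].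
Qed.

(** Integration by parts on [[0, n]], with [- s ^+ 2 * phi] as a primitive of [x * phi x]: the
    boundary term vanishes at [0] and tends to 0 at [n]. Integrands of even degree are nonnegative,
    so both sides pass to the limit by monotone convergence, with no integrability to check
    beforehand. *)
Lemma normal_moment_half (m : nat) : ~~ odd m ->
  (\int[mu]_(x in `[0%R, +oo[) (x ^+ m.+2 * phi x)%:E =
   (m.+1%:R * s ^+ 2)%:E * \int[mu]_(x in `[0%R, +oo[) (x ^+ m * phi x)%:E)%E.
Proof.
move=> mo.
have ge0 n : ~~ odd n -> forall x : R, 0 <= x ^+ n * phi x.
  by move=> no x; rewrite mulr_ge0 ?exprn_even_ge0// normal_pdf_ge0.
have mf n : measurable_fun setT (fun x : measurableTypeR R => x ^+ n * phi x).
  by apply: continuous_measurable_fun; exact: continuous_powphi.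
have := @ge0_cvgn_integral R mu _ (ge0 m mo) (mf m).
have := @ge0_cvgn_integral R mu _ (ge0 m.+2 _) (mf m.+2).
rewrite /= negbK => /(_ mo) A B.
apply/esym; apply: cvg_unique A; first exact: ereal_hausdorff.
have ibp (n : nat) : (0 < n)%N ->
  (\int[mu]_(x in `[0%R, n%:R]) (x ^+ m.+2 * phi x)%:E =
   (- s ^+ 2 * (n%:R ^+ m.+1 * phi n%:R))%:E +
   (m.+1%:R * s ^+ 2)%:E * \int[mu]_(x in `[0%R, n%:R]) (x ^+ m * phi x)%:E)%E.
  move=> n0.
  have n0' : 0 < n%:R :> R by rewrite ltr0n.
  have cont (h : R -> R) : continuous h -> derivable_oo_LRcontinuous h 0 n%:R <->
      {in `]0, n%:R[, forall x, derivable h x 1}.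
    move=> ch; split=> [[]//|dh]; split => //.
      by apply: cvg_at_right_filter; exact: ch.
    by apply: cvg_at_left_filter; exact: ch.
  have cphi : continuous phi by move=> x; exact: continuous_normal_pdf.
  have csphi : continuous (fun x => - s ^+ 2 * phi x).
    by move=> x; apply: cvgMr; exact: cphi.
  have dphi (x : R) : is_derive x 1 (fun x => - s ^+ 2 * phi x) (x * phi x).
    have ? := is_derive_normal_pdf x.
    apply: is_derive_eq; rewrite /GRing.scale/=.
    by field; rewrite sN0.
  rewrite (_ : (fun x => (x ^+ m.+2 * phi x)%:E) =
     (fun x => (x ^+ m.+1 * (x * phi x))%:E)); last first.
    by apply/funext => x; rewrite mulrA -exprSr.
  rewrite (@integration_by_parts R (fun x => x ^+ m.+1) (fun x => - s ^+ 2 * phi x)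
    (fun x => m.+1%:R * x ^+ m) (fun x => x * phi x) 0 n%:R n0').
  - rewrite expr0n mul0r subr0.
    rewrite (_ : n%:R ^+ m.+1 * _ = - s ^+ 2 * (n%:R ^+ m.+1 * phi n%:R)); last by ring.
    congr (_ + _)%E.
    have I : mu.-integrable `[0, n%:R] (fun x => (x ^+ m * phi x)%:E).
      apply: continuous_compact_integrable; first exact: segment_compact.
      by apply: continuous_subspaceT; exact: continuous_powphi.
    rewrite (_ : (fun x => (m.+1%:R * x ^+ m * (- s ^+ 2 * phi x))%:E) =
      (fun x => (- (m.+1%:R * s ^+ 2))%:E * (x ^+ m * phi x)%:E)%E); last first.
      by apply/funext => x; rewrite -EFinM; congr EFin; ring.
    by rewrite integralZl// EFinN mulNe oppeK.
  - apply: continuous_subspaceT => x; apply: cvgMr; exact: exprn_continuous.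
  - apply/cont => [x|x _]; first exact: exprn_continuous.
    exact: exprn_derivable.
  - by move=> x _; rewrite derive1E exp_derive scaler1.
  - by apply: continuous_subspaceT => x; apply: cvgM; [exact: cvg_id|exact: cphi].
  - by apply/cont => // x _; have := dphi x; case.
  - by move=> x _; rewrite derive1E; have := dphi x; case.
have e0 : (fun n : nat => (- s ^+ 2 * (n%:R ^+ m.+1 * phi n%:R))%:E) @ \oo --> 0%E.
  apply: cvg_EFin; first exact: nearW.
  rewrite -[X in _ --> X](mulr0 (- s ^+ 2)).
  apply: cvgMr; exact: cvg_pow_normal_pdf.
have := cvgeZl (y := (m.+1%:R * s ^+ 2)%:E) isT B.
move=> cI; have := cvgeD _ e0 cI; rewrite add0e => K.
have {}K := K _ ltac:(by first [rewrite fin_num_adde_defr | rewrite fin_num_adde_defl]).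
apply: cvg_trans (K eventually_filter); apply: near_eq_cvg.
by exists 1%N => //= n /= n0; rewrite ibp.
Qed.

Lemma normal_moment_even (m : nat) : ~~ odd m ->
  (\int[normal_prob 0 s]_x (x ^+ m)%:E =
   2%:E * \int[mu]_(x in `[0%R, +oo[) (x ^+ m * phi x)%:E)%E.
Proof.
move=> mo; rewrite ge0_integral_normal_prob; last 2 first.
- by move=> x; rewrite lee_fin exprn_even_ge0.
- by apply/measurable_EFinP; exact: exprn_measurable.
under eq_integral do rewrite -EFinM.
rewrite ge0_symfun_integralT.
- by rewrite set_itvcy.
- by move=> x; rewrite mulr_ge0 ?exprn_even_ge0// normal_pdf_ge0.
- exact: continuous_powphi.
- move=> x /=; rewrite exprNn -signr_odd (negbTE mo) expr0 mul1r.
  by rewrite !normal_pdfE// /normal_fun !subr0 sqrrN.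
Qed.

Lemma normal_moment_rec (m : nat) : ~~ odd m ->
  (\int[normal_prob 0 s]_x (x ^+ m.+2)%:E =
   (m.+1%:R * s ^+ 2)%:E * \int[normal_prob 0 s]_x (x ^+ m)%:E)%E.
Proof.
move=> mo; rewrite !normal_moment_even//= ?negbK// normal_moment_half//.
by rewrite muleCA.
Qed.

Lemma normal_moment2 : (\int[normal_prob 0 s]_x (x ^+ 2)%:E = (s ^+ 2)%:E)%E.
Proof.
rewrite normal_moment_rec// mul1r.
under eq_integral do rewrite expr0.
by rewrite integral_cst//= mul1e probability_setT mule1.
Qed.

Lemma normal_moment4 : (\int[normal_prob 0 s]_x (x ^+ 4)%:E = (3 * s ^+ 4)%:E)%E.
Proof.
by rewrite normal_moment_rec// normal_moment2 -EFinM; congr EFin; ring.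
Qed.

Lemma normal_prob_opp (A : set R) : measurable A ->
  normal_prob 0 s (-%R @^-1` A) = normal_prob 0 s A.
Proof.
move=> mA; rewrite /normal_prob.
transitivity (\int[mu]_(x in (-%R : _ -> measurableTypeR R) @^-1` A)
    ((EFin \o phi) \o (-%R : _ -> measurableTypeR R)) x)%E.
  apply: eq_integral => x _ /=.
  by rewrite !normal_pdfE// /normal_fun !subr0 sqrrN.
rewrite -ge0_integral_pushforward//=.
- by apply: eq_measure_integral => //= B mB _; exact: lebesgue_measureN.
- by apply/measurable_EFinP/measurable_funTS; exact: measurable_normal_pdf.
- by move=> x _; rewrite lee_fin normal_pdf_ge0.
Qed.
End normal_moments.

(** * Moments of variables with a centered Gaussian law *)

Section centered_gaussian_moments.
Context d (T : measurableType d) (R : realType) (P : probability T R).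
Variables (X : T -> R) (v : R).
Hypotheses (v0 : 0 <= v) (mX : measurable_fun setT X) (gX : centered_gaussian P X v).

(** Variance 0 is allowed: the law is then the Dirac mass at 0, and integration is evaluation at
    0. *)
Let ge0_integral_law (f : R -> \bar R) : (forall x, (0 <= f x)%E) -> measurable_fun setT f ->
  (\int[P]_w f (X w) = if (v == 0)%R then f 0%R else \int[normal_prob 0 (Num.sqrt v)]_x f x)%E.
Proof.
move=> f0 mf.
have [v00|vN0] := eqVneq v 0.
  have -> : (\int[P]_w f (X w) = \int[pushforward P X]_x f x)%E.
    by rewrite ge0_integral_pushforward.
  rewrite (@eq_measure_integral _ _ _ _ (\d_ (0 : R)))//.
    by rewrite integral_dirac// diracE mem_setT mul1e.
  by move=> A mA _; apply: etrans (gX mA) _; rewrite v00 eqxx.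
have mX' : measurable_fun setT (X : T -> measurableTypeR R) by exact: mX.
have mf' : measurable_fun setT (f : measurableTypeR R -> \bar R) by exact: mf.
transitivity (\int[pushforward P (X : T -> measurableTypeR R)]_x f x)%E.
  by rewrite ge0_integral_pushforward.
by apply: eq_measure_integral => A mA _; apply: etrans (gX mA) _; rewrite (negbTE vN0).
Qed.

Let sv0 : v != 0 -> 0 < Num.sqrt v. Proof. by move=> vN0; rewrite sqrtr_gt0 lt0r vN0. Qed.

Lemma gaussian_moment2 : (\int[P]_w (X w ^+ 2)%:E = v%:E)%E.
Proof.
rewrite (@ge0_integral_law (fun x => (x ^+ 2)%:E)); last 2 first.
- by move=> x; rewrite lee_fin sqr_ge0.
- by apply/measurable_EFinP; exact: exprn_measurable.
have [->|vN0] := eqVneq v 0; first by rewrite expr0n.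
by rewrite normal_moment2 ?sv0// sqr_sqrtr.
Qed.

Lemma gaussian_moment4 : (\int[P]_w (X w ^+ 4)%:E = (3 * v ^+ 2)%:E)%E.
Proof.
rewrite (@ge0_integral_law (fun x => (x ^+ 4)%:E)); last 2 first.
- by move=> x; rewrite lee_fin exprn_even_ge0.
- by apply/measurable_EFinP; exact: exprn_measurable.
have [->|vN0] := eqVneq v 0; first by rewrite !expr0n/= mulr0.
by rewrite normal_moment4 ?sv0// (exprM _ 2 2) sqr_sqrtr.
Qed.

Lemma gaussian_integrable : P.-integrable setT (EFin \o X).
Proof.
apply: (@le_integrable _ _ _ P _ measurableT _ (EFin \o (fun w => 1 + X w ^+ 2))).
- exact/measurable_EFinP.
- move=> w _ /=; rewrite lee_fin [leRHS]ger0_norm ?addr_ge0 ?sqr_ge0//.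
  have := sqr_ge0 (`|X w| - 1); rewrite sqrrB1 real_normK ?num_real//.
  have := normr_ge0 (X w); have := sqr_ge0 (X w); rewrite -mulr_natl.
  by move: (X w ^+ 2) `|X w| => a b; lra.
- have I1 : P.-integrable setT (EFin \o cst (1 : R)).
    exact: finite_measure_integrable_cst.
  have I2 : P.-integrable setT (EFin \o (fun w => X w ^+ 2)).
    apply/integrableP; split; first by apply/measurable_EFinP; exact: measurable_funX.
    under eq_integral do rewrite /= ger0_norm ?sqr_ge0//.
    by rewrite gaussian_moment2 ltry.
  exact: (integrableD measurableT I1 I2).
Qed.

(** No odd moment is computed: [X] and [- X] have the same law, so the finite integral equals its
    opposite. *)
Lemma gaussian_mean : \int[P]_w X w = 0.
Proof.
have X0 : (\int[P]_w (X w)%:E = \int[P]_w (- X w)%:E)%E.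
  have E (f : R -> R) : measurable_fun setT f ->
      P.-integrable setT (EFin \o (f \o X)) ->
      (\int[P]_w (f (X w))%:E = \int[pushforward P X]_x (f x)%:E)%E.
    by move=> mf If; rewrite (integral_pushforward mX)//; exact/measurable_EFinP.
  have iN : P.-integrable setT (EFin \o (-%R \o X)).
    by have := integrableN gaussian_integrable.
  rewrite (E idfun _ gaussian_integrable); last exact: measurable_id.
  rewrite (E -%R)//.
  rewrite -[RHS](@integral_pushforward _ _ _ _ _ (-%R : R -> R) _ (pushforward P X) setT EFin)//.
  - apply: eq_measure_integral => A mA _.
    have mNA : measurable (-%R @^-1` A : set R).
      by rewrite -[X in measurable X]setTI; exact: oppr_measurable.
    apply: etrans (gX mA) _; apply: esym; apply: etrans (gX mNA) _.
    have [v00|vN0] := eqVneq v 0; last by rewrite normal_prob_opp ?sv0.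
    suff E0 : ((0 : R) \in -%R @^-1` A) = ((0 : R) \in A) by rewrite !indicE E0.
    by apply/idP/idP; rewrite !inE /= oppr0.
  - rewrite preimage_setT; apply: (integrable_pushforward mX) => //.
    by apply/measurable_EFinP; exact: oppr_measurable.
rewrite /Rintegral.
have fX : (\int[P]_w (X w)%:E)%E \is a fin_num.
  exact: integrable_fin_num gaussian_integrable.
move: X0; under [X in _ = X -> _]eq_integral do rewrite EFinN.
rewrite integralN; last by rewrite integrable_add_def//; exact: gaussian_integrable.
by move: fX; case: (\int[P]_w (X w)%:E)%E => //= r _ [] ?; lra.
Qed.
End centered_gaussian_moments.

(** * Integrability and independence *)

Section square_integrable.
Context d (T : measurableType d) (R : realType) (P : probability T R).
Implicit Types f g : T -> R.

Definition intg f := P.-integrable setT (EFin \o f).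

Lemma intg_measurable f : intg f -> measurable_fun setT f.
Proof. by move=> /measurable_int /measurable_EFinP. Qed.

Lemma intg_cst (c : R) : intg (cst c).
Proof. exact: finite_measure_integrable_cst. Qed.

Lemma intgD f g : intg f -> intg g -> intg (fun w => f w + g w).
Proof. exact: integrableD. Qed.

Lemma intgZ (c : R) f : intg f -> intg (fun w => c * f w).
Proof. exact: integrableZl. Qed.

Lemma intg_sum I (r : seq I) (Q : pred I) (F : I -> T -> R) :
  (forall i, Q i -> intg (F i)) -> intg (fun w => \sum_(i <- r | Q i) F i w).
Proof.
move=> iF; rewrite /intg (_ : _ \o _ = (fun w => \sum_(i <- r | Q i) (F i w)%:E)%E).
  exact: integrable_sum.
by apply/funext => w /=; rewrite sumEFin.
Qed.

Lemma Rintegral_sum I (r : seq I) (Q : pred I) (F : I -> T -> R) :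
  (forall i, Q i -> intg (F i)) ->
  \int[P]_w (\sum_(i <- r | Q i) F i w) = \sum_(i <- r | Q i) \int[P]_w F i w.
Proof.
move=> iF; elim: r => [|i r IH].
  under eq_Rintegral do rewrite big_nil.
  by rewrite Rintegral_cst// mul0r big_nil.
rewrite big_cons; under eq_Rintegral do rewrite big_cons.
by case Qi: (Q i) => //; rewrite RintegralD ?IH//; [exact: iF|exact: intg_sum].
Qed.

Lemma le_intg f g : measurable_fun setT f -> (forall w, `|f w| <= g w) ->
  intg g -> intg f.
Proof.
move=> mf fg; apply: le_integrable => //; first exact/measurable_EFinP.
by move=> w _ /=; rewrite lee_fin (le_trans (fg w))// ler_norm.
Qed.

(** Measurability of [f] is a separate component because it does not follow from that of
    [f ^+ 2]. *)
Definition sqintg f := measurable_fun setT f /\ intg (fun w => f w ^+ 2).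

Lemma sqintgM f g : sqintg f -> sqintg g -> intg (fun w => f w * g w).
Proof.
move=> [mf f2] [mg g2].
apply: le_intg (intgD f2 g2); first exact: measurable_funM.
move=> w; have := sqr_ge0 (f w - g w); have := sqr_ge0 (f w + g w).
rewrite ler_norml.
have := sqr_ge0 (f w); have := sqr_ge0 (g w).
by move: (f w) (g w) => a b *; apply/andP; split; nra.
Qed.

Lemma sqintg_intg f : sqintg f -> intg f.
Proof.
move=> [mf f2]; apply: le_intg (intgD (intg_cst 1) f2) => // w /=.
have := sqr_ge0 (`|f w| - 1); rewrite sqrrB1 real_normK ?num_real// -mulr_natl.
by have := sqr_ge0 (f w); move: (f w ^+ 2) `|f w| => a b; lra.
Qed.

Lemma sqintgD f g : sqintg f -> sqintg g -> sqintg (fun w => f w + g w).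
Proof.
move=> Lf Lg; split; first by apply: measurable_funD; [exact: Lf.1|exact: Lg.1].
rewrite (_ : (fun w => _) = (fun w => (f w ^+ 2 + 2 * (f w * g w)) + g w ^+ 2)).
  apply: intgD Lg.2; apply: intgD Lf.2 _; apply: intgZ; exact: sqintgM.
by apply/funext => w; rewrite sqrrD mulr_natl.
Qed.

Lemma sqintgZ (c : R) f : sqintg f -> sqintg (fun w => c * f w).
Proof.
move=> [mf f2]; split; first exact: measurable_funM.
by under eq_fun do rewrite exprMn; exact: intgZ.
Qed.

Lemma sqintg_cst (c : R) : sqintg (cst c).
Proof. split => //; exact: (intg_cst (c ^+ 2)). Qed.

Lemma sqintgN f : sqintg f -> sqintg (fun w => - f w).
Proof. by move=> /(sqintgZ (-1)); under eq_fun do rewrite mulN1r. Qed.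

Lemma sqintgB f g : sqintg f -> sqintg g -> sqintg (fun w => f w - g w).
Proof. by move=> Lf /sqintgN; exact: sqintgD. Qed.

Lemma sqintg_sum I (r : seq I) (Q : pred I) (F : I -> T -> R) :
  (forall i, Q i -> sqintg (F i)) -> sqintg (fun w => \sum_(i <- r | Q i) F i w).
Proof.
move=> LF; elim: r => [|i r IH].
  by under eq_fun do rewrite big_nil; exact: (sqintg_cst 0).
under eq_fun do rewrite big_cons.
by case Qi: (Q i) => //; apply: sqintgD => //; exact: LF.
Qed.

Lemma le_sqintg f g : measurable_fun setT f -> (forall w, `|f w| <= `|g w|) ->
  sqintg g -> sqintg f.
Proof.
move=> mf fg [mg g2]; split => //; apply: le_intg g2; first exact: measurable_funX.
move=> w; rewrite ger0_norm ?sqr_ge0//.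
by rewrite -(real_normK (num_real (f w))) -(real_normK (num_real (g w))) lerXn2r// nnegrE.
Qed.

Lemma ge0_intg f : measurable_fun setT f -> (forall w, 0 <= f w) ->
  (\int[P]_w (f w)%:E < +oo)%E -> intg f.
Proof.
move=> mf f0 foo; apply/integrableP; split; first exact/measurable_EFinP.
by under eq_integral do rewrite /= ger0_norm//.
Qed.

Lemma EFin_Rintegral f : intg f -> ((\int[P]_w f w)%:E = \int[P]_w (f w)%:E)%E.
Proof. by move=> If; rewrite fineK//; exact: integrable_fin_num If. Qed.

Lemma Rintegral1 (c : R) : \int[P]_w c = c.
Proof. by rewrite Rintegral_cst// (_ : fine _ = 1) ?mulr1//; exact: congr1 (probability_setT P). Qed.

End square_integrable.

Section indep_product.
Context d (T : measurableType d) (R : realType) (P : probability T R).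

(** The factorization on rectangles identifies the joint law of [(U, V)] with the product of the
    marginal laws; Tonelli gives integrability of the product and Fubini its value. *)
Lemma indep_integral (U V : T -> R) :
  (forall A B : set R, measurable A -> measurable B ->
    P (U @^-1` A `&` V @^-1` B) = (P (U @^-1` A) * P (V @^-1` B))%E) ->
  intg P U -> intg P V ->
  intg P (fun w => U w * V w) /\
  \int[P]_w (U w * V w) = (\int[P]_w U w) * (\int[P]_w V w).
Proof.
move=> ind iU iV.
have mU := intg_measurable iU; have mV := intg_measurable iV.
pose X : {mfun T >-> R} := HB.pack U (isMeasurableFun.Build _ _ _ _ _ mU).
pose Y : {mfun T >-> R} := HB.pack V (isMeasurableFun.Build _ _ _ _ _ mV).
have mUV : measurable_fun setT (fun w => (U w, V w)) by exact: measurable_fun_pair.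
pose XY : {mfun T >-> (R * R)%type} := HB.pack (fun w => (U w, V w)) (isMeasurableFun.Build _ _ _ _ _ mUV).
pose PX := distribution P X; pose PY := distribution P Y.
have XYE (A : set (R * R)) : measurable A -> (PX \x PY)%E A = distribution P XY A.
  by move=> mA; apply: product_measure_unique.
pose f (z : R * R) := (z.1 * z.2)%:E.
have mf : measurable_fun setT f.
  by apply/measurable_EFinP; apply: measurable_funM.
have lawX g : measurable_fun setT g -> (forall y, (0 <= g y)%E) ->
  (\int[PX]_x g x = \int[P]_w g (U w))%E.
  by move=> mg g0; rewrite /PX ge0_integral_distribution.
have lawY g : measurable_fun setT g -> (forall y, (0 <= g y)%E) ->
  (\int[PY]_x g x = \int[P]_w g (V w))%E.
  by move=> mg g0; rewrite /PY ge0_integral_distribution.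
have If : (PX \x PY)%E.-integrable setT f.
  apply/(integrable12ltyP _ _ mf).
  under eq_integral => x _.
    under eq_integral do rewrite /f /= normrM EFinM.
    rewrite ge0_integralZl//=; last by apply/measurable_EFinP; exact: normr_measurable.
    rewrite (lawY (fun y => (`|y|)%:E))//; last by apply/measurable_EFinP; exact: normr_measurable.
    over.
  have /integrableP[_ Voo] := iV; have /integrableP[_ Uoo] := iU.
  have mn : measurable_fun [set: R] (fun y : R => (`|y|)%:E).
    by apply/measurable_EFinP; exact: normr_measurable.
  rewrite ge0_integralZr//; last exact: integral_ge0.
  rewrite (lawX (fun y => (`|y|)%:E))// lte_mul_pinfty ?integral_ge0//.
  by rewrite ge0_fin_numE// integral_ge0.
have IUV : intg P (fun w => U w * V w).
  apply/integrableP; split.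
    by apply/measurable_EFinP; exact: measurable_funM.
  move/integrableP : If => [_].
  rewrite (eq_measure_integral (distribution P XY)) => [|A mA _]; last exact: XYE.
  by rewrite ge0_integral_distribution//; exact: measurableT_comp.
split => //.
have <- : fine (\int[(PX \x PY)%E]_z f z)%E = \int[P]_w (U w * V w).
  congr fine; rewrite (eq_measure_integral (distribution P XY)) => [|A mA _]; last exact: XYE.
  by rewrite integral_distribution.
rewrite -integral12_prod_meas1//.
have EY : (\int[PY]_y y%:E = (\int[P]_w V w)%:E)%E.
  by rewrite EFin_Rintegral// /PY integral_distribution.
have IY : PY.-integrable setT EFin.
  by apply: integrable_pushforward.
rewrite (eq_integral (fun x : R => x%:E * (\int[P]_w V w)%:E)%E); last first.
  by move=> x _; rewrite /fubini_F /f /=; under eq_integral do rewrite EFinM; rewrite integralZl// EY.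
have IX : PX.-integrable setT EFin.
  by apply: integrable_pushforward.
rewrite integralZr//= fineM//; last exact: integrable_fin_num.
by rewrite /Rintegral; congr (fine _ * _); rewrite /PX integral_distribution.
Qed.

End indep_product.

(** * Sigma-algebras generated by families of independent variables *)

Section cylinders.
Context d (T : measurableType d) (R : realType) (P : probability T R)
  (I : eqType) (Z : I -> T -> R).
Hypothesis mZ : forall i, measurable_fun setT (Z i).

(** The pi-system of finite intersections of events on the coordinates in [J]; it generates the
    sigma-algebra of the variables indexed by [J]. *)
Definition cylinder (J : set I) : set (set T) :=
  [set A | exists (s : seq I) (B : I -> set R),
    [/\ uniq s, [set` s] `<=` J, forall i, measurable (B i) &
        A = \bigcap_(i in [set` s]) (Z i @^-1` B i)]].

(** Adaptedness: [f] depends only on the variables with index in [J]. *)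
Definition cyl_measurable (J : set I) (f : T -> R) :=
  measurable_fun [set: g_sigma_algebraType (cylinder J)]
    (f : g_sigma_algebraType (cylinder J) -> R).

Lemma cylinder_measurable J : cylinder J `<=` measurable.
Proof.
move=> A [s [B [us sJ mB ->]]]; apply: fin_bigcap_measurable => // i _.
by rewrite -[X in measurable X]setTI; exact: mZ.
Qed.

Lemma sigma_cylinder_measurable J : <<s cylinder J >> `<=` measurable.
Proof.
by apply: smallest_sub; [exact: sigma_algebra_measurable|exact: cylinder_measurable].
Qed.

Lemma cyl_measurableW J f : cyl_measurable J f -> measurable_fun setT f.
Proof. by move=> mf _ B mB; apply: (@sigma_cylinder_measurable J); exact: mf. Qed.

Lemma cylinderS J K : J `<=` K -> cylinder J `<=` cylinder K.
Proof.
by move=> JK A [s [B [us sJ mB ->]]]; exists s, B; split => //; exact: subset_trans JK.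
Qed.

Lemma cyl_measurableS J K f : J `<=` K -> cyl_measurable J f -> cyl_measurable K f.
Proof.
move=> JK mf _ B mB; have := mf measurableT B mB.
by apply: sub_smallest2r; [exact: smallest_sigma_algebra|exact: cylinderS].
Qed.

Lemma cyl_measurable_coord (J : set I) i : J i -> cyl_measurable J (Z i).
Proof.
move=> Ji _ B mB; rewrite setTI; apply: sub_sigma_algebra.
exists [:: i], (fun=> B); split => //.
  by move=> j /=; rewrite inE => /eqP ->.
by apply/seteqP; split => [w Bw j /=|w /(_ i) /=]; [rewrite inE => /eqP->|apply; exact: mem_head].
Qed.

Lemma cylinder_setI J : setI_closed (cylinder J).
Proof.
move=> _ _ [s [A [us sJ mA ->]]] [t [B [ut tJ mB ->]]].
pose C i := (if i \in s then A i else setT) `&` (if i \in t then B i else setT).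
exists (undup (s ++ t)), C; split.
- exact: undup_uniq.
- move=> i /=; rewrite mem_undup mem_cat => /orP[]; [exact: sJ|exact: tJ].
- by move=> i; apply: measurableI; case: ifP.
- apply/seteqP; split => [w [Aw Bw] i /= _|w H].
    split => /=; case: ifPn => // ii; [exact: Aw|exact: Bw].
  split => i /= ii.
    have /= := H i; rewrite mem_undup mem_cat ii/= => /(_ isT)[].
    by rewrite /C ii.
  have /= := H i; rewrite mem_undup mem_cat ii orbT => /(_ isT)[_].
  by rewrite /C ii.
Qed.

Hypothesis indepZ : mutually_independent P Z.

(** Dynkin's argument: for fixed [B], both sides are finite measures in [A]. On a cylinder over [J]
    they agree by mutual independence, applied to the index list extended by [a], which [~ J a]
    keeps duplicate-free; a pi-system determines a finite measure on the sigma-algebra it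
    generates. *)
Lemma cylinder_indep J a (A : set T) (B : set R) : ~ J a ->
  <<s cylinder J >> A -> measurable B ->
  P (A `&` Z a @^-1` B) = (P A * P (Z a @^-1` B))%E.
Proof.
move=> Ja sA mB.
have mF : measurable (Z a @^-1` B) by rewrite -[X in measurable X]setTI; exact: mZ.
have PF0 : 0 <= fine (P (Z a @^-1` B)) by exact: fine_ge0.
pose m1 : {measure set T -> \bar R} := mrestr P mF.
pose m2 : {measure set T -> \bar R} := mscale (NngNum PF0) P.
have E2 X : m2 X = (P X * P (Z a @^-1` B))%E.
  by rewrite /m2 /= /mscale /= fineK ?fin_num_measure// muleC.
rewrite -E2; change (m1 A = m2 A).
apply: (@g_sigma_algebra_measure_unique _ _ _ (cylinder J) _ (fun=> setT)) => //.
- exact: cylinder_measurable.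
- move=> _; exists [::], (fun=> setT); split => //.
  by rewrite set_nil bigcap_set0.
- by apply/seteqP; split => // x _; exists 0%N.
- exact: cylinder_setI.
- move=> _ [s [C [us sJ mC ->]]]; rewrite E2.
  have as_ : a \notin s by apply/negP => as_; apply: Ja; exact: sJ.
  pose C' i := if i == a then B else C i.
  have mC' i : measurable (C' i) by rewrite /C'; case: ifP.
  have CE i : i \in s -> C' i = C i.
    by move=> is_; rewrite /C'; case: eqP => // ia; rewrite -ia is_ in as_.
  have E3 : \bigcap_(i in [set` s]) (Z i @^-1` C i) =
            \bigcap_(i in [set` s]) (Z i @^-1` C' i).
    by apply: eq_bigcapr => i /= is_; rewrite CE.
  have := @indepZ (a :: s) C'; rewrite /= as_ us => /(_ isT mC').
  rewrite big_cons -(@indepZ s C' us mC').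
  rewrite {2}/C' eqxx -E3 muleC => <-.
  rewrite /m1/= /mrestr E3; congr (P _).
  apply/seteqP; split => [w [H1 H2] i /=|w H].
    rewrite inE => /orP[/eqP ->|]; last exact: H1.
    by rewrite /C' eqxx.
  split; last by have := H a; rewrite /= mem_head /C' eqxx; apply.
  by move=> i /= is_; apply: H; rewrite /= inE is_ orbT.
- by move=> _; rewrite /m1/= /mrestr (le_lt_trans (probability_le1 P _)) ?ltry//; exact: measurableI.
Qed.

(** The substitute for conditioning on the variables in [J]: a function of one fresh variable leaves
    the integral as its mean. *)
Lemma indep_pull J a (W : T -> R) (phi : R -> R) : ~ J a -> cyl_measurable J W ->
  measurable_fun setT phi -> intg P W -> intg P (phi \o Z a) ->
  intg P (fun w => W w * phi (Z a w)) /\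
  \int[P]_w (W w * phi (Z a w)) = (\int[P]_w W w) * (\int[P]_w phi (Z a w)).
Proof.
move=> Ja mW mphi iW iphi; apply: (indep_integral (V := phi \o Z a)) => // A B mA mB.
rewrite comp_preimage (cylinder_indep Ja)//.
  by have := mW measurableT A mA; rewrite setTI.
by rewrite -[X in measurable X]setTI; exact: mphi.
Qed.

Lemma indep_pull0 J a (W : T -> R) : ~ J a -> cyl_measurable J W ->
  intg P W -> intg P (Z a) -> \int[P]_w Z a w = 0 ->
  intg P (fun w => W w * Z a w) /\ \int[P]_w (W w * Z a w) = 0.
Proof.
move=> Ja mW iW iZ Z0.
have [? E] := @indep_pull J a W idfun Ja mW (@measurable_id _ _ _) iW iZ.
by split => //; rewrite E Z0 mulr0.
Qed.

End cylinders.

(** * Almost sure convergence of random series *)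

Section almost_sure_series.
Context d (T : measurableType d) (R : realType) (P : probability T R).

Lemma cvgn_series_ge0_le (u : nat -> R) (M : R) : (forall k, 0 <= u k) ->
  (forall n, series u n <= M) -> cvgn (series u).
Proof.
move=> u0 uM; apply: nondecreasing_is_cvgn.
  by apply/nondecreasing_seqP => n; rewrite /series/= big_nat_recr//= lerDl.
by exists M => _ [n _ <-].
Qed.

Lemma series_le_limn (u : nat -> R) n : (forall k, 0 <= u k) ->
  cvgn (series u) -> series u n <= limn (series u).
Proof.
move=> u0 cu; apply: nondecreasing_cvgn_le => //.
by apply/nondecreasing_seqP => m; rewrite /series/= big_nat_recr//= lerDl.
Qed.

(** By monotone convergence the extended-valued sum has expectation at most [M], so it is finite
    almost everywhere. *)
Lemma ae_cvgn_series_ge0 (f : nat -> T -> R) (M : R) : (forall k w, 0 <= f k w) ->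
  (forall k, intg P (f k)) -> (forall n, \sum_(k < n) \int[P]_w f k w <= M) ->
  {ae P, forall w, cvgn (series (fun k => f k w))}.
Proof.
move=> f0 If fM.
have mf k : measurable_fun setT (EFin \o f k) by exact: measurable_int (If k).
pose g w := (\sum_(k <oo) (f k w)%:E)%E.
have g0 w : (0 <= g w)%E by apply: nneseries_ge0 => k _ _; rewrite lee_fin.
have mg : measurable_fun setT g.
  by apply: ge0_emeasurable_sum => [k w _ _|k _]; [rewrite lee_fin|exact: mf].
have Ig : P.-integrable setT g.
  apply/integrableP; split => //.
  under eq_integral do rewrite gee0_abs//.
  rewrite /g integral_nneseries//; last by move=> k w _; rewrite lee_fin.
  apply: (@le_lt_trans _ _ M%:E); last exact: ltry.
  apply: lime_le.
    by apply: is_cvg_nneseries => k _ _; apply: integral_ge0 => w _; rewrite lee_fin.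
  apply: nearW => n; rewrite big_mkord.
  under eq_bigr do rewrite -EFin_Rintegral//.
  by rewrite sumEFin lee_fin.
have := integrable_ae measurableT Ig; apply: filterS => w /(_ I) gw.
apply: (@cvgn_series_ge0_le _ (fine (g w))) => // n.
rewrite -lee_fin fineK// /series/= -sumEFin.
by apply: nneseries_lim_ge => k _; rewrite lee_fin.
Qed.

End almost_sure_series.

(** * Almost sure convergence of martingale series with summable variances *)

Section martingale_series.
Context d (T : measurableType d) (R : realType) (P : probability T R).
Variables (G : nat -> set (set T)) (X : nat -> T -> R).
Let mes k (f : T -> R) := measurable_fun [set: g_sigma_algebraType (G k)]
  (f : g_sigma_algebraType (G k) -> R).
Hypothesis GS : forall k, G k `<=` G k.+1.
Hypothesis Gm : forall k, <<s G k >> `<=` measurable.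
Hypothesis mX : forall k, mes k.+1 (X k).
Hypothesis LX : forall k, sqintg P (X k).
(** The martingale property in weak form: [X k] has conditional mean 0 given [G k], tested on
    bounded functions. *)
Hypothesis orthX : forall k (U : T -> R) (M : R), mes k U ->
  (forall w, `|U w| <= M) -> \int[P]_w (U w * X k w) = 0.
Hypothesis sumX : cvgn (series (fun k => \int[P]_w (X k w ^+ 2))).

Let a k := \int[P]_w (X k w ^+ 2).

Let a_ge0 k : 0 <= a k.
Proof. by apply: Rintegral_ge0 => w _; exact: sqr_ge0. Qed.

Let mesT k f : mes k f -> measurable_fun setT f.
Proof. by move=> mf _ B mB; apply: (Gm (k:=k)); exact: mf. Qed.

Let mesS k f : mes k f -> mes k.+1 f.
Proof.
move=> mf _ B mB; have := mf measurableT B mB.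
by apply: sub_smallest2r; [exact: smallest_sigma_algebra|exact: GS].
Qed.

(* The partial sum from rank [n] on, frozen at the first time it reaches [eps]:
   the maximum of the partial sums exceeds [eps] iff the frozen sum ends there,
   so Chebyshev's inequality for the frozen sum is a maximal inequality. *)
Fixpoint stopped_sum (eps : R) (n j : nat) (w : T) : R :=
  if j is j'.+1 then
    if `|stopped_sum eps n j' w| < eps
    then stopped_sum eps n j' w + X (n + j') w else stopped_sum eps n j' w
  else 0.

Section fixed_rank.
Variables (eps : R) (n : nat).
Hypothesis eps0 : 0 < eps.
Let S := stopped_sum eps n.

Let mtest j : mes (n + j) (S j) ->
  measurable_fun [set: g_sigma_algebraType (G (n + j))]
    (fun w : g_sigma_algebraType (G (n + j)) => `|S j w| < eps).
Proof.
move=> mS; apply: measurable_fun_ltr; last exact: measurable_cst.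
by apply: measurableT_comp => //; exact: (@mS j).
Qed.

Let mS j : mes (n + j) (S j).
Proof.
elim: j => [|j IH]; first exact: measurable_cst.
rewrite addnS; have E : S j.+1 = fun w => if `|S j w| < eps then S j w + X (n + j) w else S j w by [].
rewrite E /mes; apply: measurable_fun_ifT.
- move=> _ B mB; have := mtest IH measurableT mB.
  by apply: sub_smallest2r; [exact: smallest_sigma_algebra|exact: GS].
- by apply: measurable_funD; [exact: (mesS IH)|exact: mX].
- exact: mesS IH.
Qed.

Let U j w := if `|S j w| < eps then S j w else 0.
Let H j w : R := if `|S j w| < eps then 1 else 0.

Let mU j : mes (n + j) (U j).
Proof.
have E : U j = fun w => if `|S j w| < eps then S j w else 0 by [].
rewrite E /mes; apply: measurable_fun_ifT; first exact: mtest (@mS j).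
- exact: (@mS j).
- exact: measurable_cst.
Qed.

Let mH j : mes (n + j) (H j).
Proof.
have E : H j = fun w => if `|S j w| < eps then 1 else 0 by [].
rewrite E /mes; apply: measurable_fun_ifT; first exact: mtest (@mS j).
- exact: measurable_cst.
- exact: measurable_cst.
Qed.

Let U_le j w : `|U j w| <= eps.
Proof. by rewrite /U; case: ifPn => [/ltW//|_]; rewrite normr0 ltW. Qed.

Let LHX j : sqintg P (fun w => H j w * X (n + j) w).
Proof.
apply: le_sqintg (LX (n + j)).
  by apply: measurable_funM; [exact: mesT (@mH j)|exact: (LX _).1].
move=> w; rewrite normrM /H; case: ifPn => _; first by rewrite normr1 mul1r.
by rewrite normr0 mul0r.
Qed.

Let SE j w : S j.+1 w = S j w + H j w * X (n + j) w.
Proof. by rewrite /S /H /=; case: ifPn => _; rewrite ?mul1r// mul0r addr0. Qed.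

Let LS j : sqintg P (S j).
Proof.
elim: j => [|j IH]; first exact: (sqintg_cst P 0).
by rewrite (_ : S j.+1 = (fun w => S j w + H j w * X (n + j) w)) ?funeqE//; exact: sqintgD.
Qed.

Let stopped_sum_moment2 j :
  \int[P]_w (S j w ^+ 2) <= \sum_(i < j) a (n + i).
Proof.
elim: j => [|j IH].
  by rewrite big_ord0; under eq_Rintegral do rewrite /S/= expr0n/=; rewrite Rintegral1.
have LU : sqintg P (U j).
  apply: le_sqintg (sqintg_cst P eps); first exact: mesT (@mU j).
  by move=> w; rewrite (le_trans (U_le j w))// ler_norm.
(* The cross term carries [U] instead of [S] because nothing is added once the sum is frozen;
   [orthX] then cancels it. *)
have SE2 w : S j.+1 w ^+ 2 =
    (S j w ^+ 2 + 2 * (U j w * X (n + j) w)) + (H j w * X (n + j) w) ^+ 2.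
  by rewrite SE /U /H; case: ifPn => _; ring.
under eq_Rintegral do rewrite SE2.
have I1 := (LS j).2; have I2 := intgZ 2 (sqintgM LU (LX (n + j))); have I3 := (LHX j).2.
rewrite RintegralD//; last exact: intgD.
rewrite RintegralD// RintegralZl//; last exact: sqintgM.
rewrite (orthX (@mU j) (U_le j)) mulr0 addr0 big_ord_recr lerD//=.
apply: le_Rintegral => //; first exact: (LX _).2.
move=> w _; rewrite exprMn /H; case: ifPn => _; rewrite ?expr1n ?mul1r//.
by rewrite expr0n mul0r sqr_ge0.
Qed.

Let E j := [set w | eps <= `|S j w|].

Let mE j : measurable (E j).
Proof.
rewrite -[X in measurable X]setTI; apply: (measurable_fun_ler (f := cst eps) _ _ measurableT (Y := [set true])) => //.
by apply: measurableT_comp => //; exact: mesT (@mS j).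
Qed.

Let probaE j : (P (E j) <= ((\sum_(i < j) a (n + i)) / eps ^+ 2)%:E)%E.
Proof.
have m2 : measurable_fun setT (fun w => (S j w ^+ 2)%:E).
  by apply/measurable_EFinP; exact: intg_measurable (LS j).2.
have e2 : 0 < eps ^+ 2 by exact: exprn_gt0.
have K : ((eps ^+ 2)%:E * P (E j) <= \int[P]_w `|(S j w ^+ 2)%:E|)%E.
  rewrite (_ : E j = setT `&` [set w | ((eps ^+ 2)%:E <= `|(S j w ^+ 2)%:E|)%E]).
    exact: le_integral_abse.
  rewrite setTI; apply/seteqP; split => w /=; rewrite ?lee_fin normrX.
    by rewrite ler_sqr ?nnegrE ?(ltW eps0).
  by rewrite ler_sqr ?nnegrE ?(ltW eps0).
move: K; under eq_integral do rewrite gee0_abs ?lee_fin ?sqr_ge0//.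
rewrite -EFin_Rintegral; last exact: (LS j).2.
have Pf : P (E j) \is a fin_num by exact: fin_num_measure.
rewrite -(fineK Pf) -EFinM !lee_fin mulrC -ler_pdivlMr// => /le_trans; apply.
by rewrite ler_pM2r ?invr_gt0//; exact: stopped_sum_moment2.
Qed.

(** A frozen sum keeps its value, so the events [E j] increase and continuity from below applies.
    The bounds on [E j] are all dominated by the tail of the variances from rank [n]. *)
Lemma stopped_sum_exceeds :
  measurable (\bigcup_j E j) /\
  (P (\bigcup_j E j) <=
    ((limn (series a) - series a n) / eps ^+ 2)%:E)%E.
Proof.
have mUE : measurable (\bigcup_j E j) by exact: bigcupT_measurable.
split => //.
have nE : {homo E : j k / (j <= k)%N >-> (j <= k)%O}.
  apply/nondecreasing_seqP => j; apply/subsetPset => w; rewrite /E /S /= => Ew.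
  by rewrite ltNge Ew.
have cE := nondecreasing_cvg_mu (mu := P) mE mUE nE.
rewrite -(cvg_lim _ cE)//; apply: lime_le; first by apply/cvg_ex; eexists; exact: cE.
apply: nearW => j; apply: (le_trans (probaE j)).
rewrite lee_fin ler_pM2r ?invr_gt0 ?exprn_gt0// lerBrDl.
have := series_le_limn (n + j) a_ge0 sumX; apply: le_trans.
rewrite addnC series_addn lerD2l.
rewrite -{2}[n]add0n big_addn addnK big_mkord.
by under [leRHS]eq_bigr do rewrite addnC.
Qed.

Lemma stopped_sum_never w : ~ (\bigcup_j E j) w ->
  forall m, `|\sum_(n <= k < n + m) X k w| < eps.
Proof.
move=> nE.
have SX m : S m w = \sum_(n <= k < n + m) X k w.
  elim: m => [|m IH]; first by rewrite addn0 big_geq.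
  rewrite addnS big_nat_recr ?leq_addr//= -IH /S /=.
  by case: ifPn => //; rewrite -leNgt => eS; exfalso; apply: nE; exists m.
by move=> m; rewrite -SX ltNge; apply/negP => eS; apply: nE; exists m.
Qed.

End fixed_rank.

(** The partial sums are almost surely Cauchy; thresholds of the form [1 / (q + 1)] keep the number
    of exceptional null sets countable. *)
Lemma ae_cvgn_martingale_series : {ae P, forall w, cvgn (series (fun k => X k w))}.
Proof.
have H q : {ae P, forall w, exists n, forall m, `|\sum_(n <= k < n + m) X k w| < q.+1%:R^-1}.
  set eps : R := q.+1%:R^-1.
  have e0 : 0 < eps by rewrite invr_gt0.
  (* A bad path exceeds [eps] from every starting rank. The intersection of the [E n] is bounded by
     every tail of the variances, hence is null. *)
  pose E n := \bigcup_j [set w | eps <= `|stopped_sum eps n j w|].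
  have EP n := stopped_sum_exceeds n e0.
  exists (\bigcap_n E n); split.
  - by apply: bigcapT_measurable => n; exact: (EP n).1.
  - apply/eqP; rewrite eq_le measure_ge0 andbT.
    have c0 : ((limn (series a) - series a n) / eps ^+ 2)%:E @[n --> \oo] --> 0%:E.
      apply: cvg_EFin; first exact: nearW.
      rewrite -[X in _ --> X](mul0r (eps ^- 2)); apply: cvgMl.
      rewrite -[X in _ --> X](subrr (limn (series a))).
      by apply: cvgB; [exact: cvg_cst|exact: sumX].
    suff : (P (\bigcap_n E n) <= limn (fun n => ((limn (series a) - series a n) / eps ^+ 2)%:E))%E.
      by rewrite (cvg_lim _ c0).
    apply: lime_ge; first by apply/cvg_ex; eexists; exact: c0.
    apply: nearW => n; apply: le_trans (EP n).2.
    apply: le_measure; rewrite ?inE.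
    + by apply: bigcapT_measurable => m; exact: (EP m).1.
    + exact: (EP n).1.
    + by move=> w; apply.
  - move=> w /= nw n _; apply: contrapT => nE; apply: nw; exists n.
    exact: (stopped_sum_never nE).
have := ae_foralln H; apply: filterS => w Hw.
apply: cauchy_cvg; apply: cauchy_exP => e e0 /=.
have [q qe] : exists q : nat, q.+1%:R^-1 < e.
  exists (Num.trunc e^-1); rewrite invf_plt ?posrE//; exact: truncnS_gt.
have [n Hn] := Hw q; exists (series (fun k => X k w) n); exists n => // m /= nm.
rewrite /ball/= distrC sub_series nm.
by rewrite (lt_trans _ qe)// -{1}(subnKC nm).
Qed.

End martingale_series.

(** * Lyapunov functions and consensus along a path *)

Section deterministic.
Context {R : realType}.

Lemma series_shift (u : nat -> R) n m :
  series u (n + m)%N = series u m + \sum_(k < n) u (k + m)%N.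
Proof.
rewrite series_addn; congr (_ + _).
by rewrite -[X in \sum_(X <= _ < _) _]add0n big_addn addnK big_mkord.
Qed.

(** Subtracting the partial sums of [mu] and [s] leaves a nonincreasing sequence, bounded below
    since convergent series have bounded partial sums. The sign of [mu] is free, so that martingale
    terms fit. *)
Lemma cvgn_quasi_decreasing (W mu s : nat -> R) : (forall k, 0 <= W k) ->
  (forall k, W k.+1 <= W k + mu k + s k) ->
  cvgn (series mu) -> cvgn (series s) -> cvgn W.
Proof.
move=> W0 WS cmu cs.
have cT : cvgn (series mu + series s) by exact: is_cvgD.
have cU : cvgn (W - (series mu + series s)).
  apply: nonincreasing_is_cvgn.
    apply/nonincreasing_seqP => n.
    rewrite !fctE /series/= !big_nat_recr//=; have := WS n.
    by move: (W n.+1) (W n) (mu n) (s n) (\sum_(0 <= k < n) _) (\sum_(0 <= k < n) _) => *; lra.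
  have /cvg_seq_bounded[M [_ HM]] := cT.
  exists (- (M + 1)) => _ [n _ <-]; rewrite !fctE.
  have := HM (M + 1) _ n I; rewrite ltrDl ltr01 => /(_ isT) /=.
  by rewrite fctE ler_norml => /andP[_]; have := W0 n; lra.
have : cvgn ((W - (series mu + series s)) + (series mu + series s)).
  by apply: is_cvgD.
by rewrite subrK.
Qed.

(* The square root is concave, so the terms [2 W mu] become the summable [mu];
   this lets the martingale part have bounded coefficients. *)
Lemma cvgn_sqrt_lyapunov (V mu s : nat -> R) : (forall k, 0 <= V k) ->
  (forall k, 0 <= s k) ->
  (forall k, V k.+1 <= V k + 2 * (Num.sqrt (1 + V k) * mu k) + s k) ->
  cvgn (series mu) -> cvgn (series s) -> cvgn V.
Proof.
move=> V0 s0 VS cmu cs.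
pose W k := Num.sqrt (1 + V k).
have W2 k : W k ^+ 2 = 1 + V k by rewrite sqr_sqrtr// addr_ge0.
have W1 k : 1 <= W k.
  by rewrite -[leLHS](sqrtr1 R) ler_sqrt ?addr_ge0// lerDl.
have cW : cvgn W.
  apply: (@cvgn_quasi_decreasing W mu s) => // [k|k]; first exact: sqrtr_ge0.
  have := VS k; rewrite -/(W k) => VSk.
  have := W2 k; have := W2 k.+1; have := W1 k; have := s0 k.
  have : 0 <= W k.+1 by exact: sqrtr_ge0.
  move: VSk; move: (W k) (W k.+1) (V k) (V k.+1) (mu k) (s k) => w w' v v' m t VSk w'0 t0 w1 E' E.
  (* [2 w (w' - w) <= w'^2 - w^2 <= 2 w m + t <= 2 w (m + t)], the last step by [w >= 1]; dividing
     by [2 w] contradicts [H]. *)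
  rewrite leNgt; apply/negP => H.
  have : 0 <= (w' - w) ^+ 2 by exact: sqr_ge0.
  have K : 0 < 2 * w * (w' - (w + m + t)) by apply: mulr_gt0; lra.
  by nra.
rewrite (_ : V = (fun k => W k * W k - 1)); last first.
  by apply/funext => k; rewrite -expr2 W2 addrAC subrr add0r.
by apply: is_cvgB; [exact: is_cvgM|exact: is_cvg_cst].
Qed.

Variable N : nat.
Implicit Types (a : 'I_N -> 'I_N -> R) (y : 'I_N -> R).

Lemma drift_le a y (c : R) : 0 <= c -> (forall i j, 0 <= a i j) ->
  (forall i j, a i j = a j i) ->
  2 * \sum_i (y i - c) * (\sum_j a i j * (Num.max (y j) 0 - y i)) <=
  - \sum_i \sum_j a i j * (y i - Num.max (y j) 0) ^+ 2.
Proof.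
move=> c0 a0 aC.
pose e j := Num.max (y j) 0 - c; pose b i := y i - c.
have eb j : e j ^+ 2 <= b j ^+ 2.
  by rewrite /e /b; case: (leP 0 (y j)) => y0 //; nra.
(* Polarization: [2 b (e - b) = e^2 - b^2 - (b - e)^2], and [c] cancels in [b i - e j]. *)
have E : 2 * \sum_i (y i - c) * (\sum_j a i j * (Num.max (y j) 0 - y i)) =
   - (\sum_i \sum_j a i j * (y i - Num.max (y j) 0) ^+ 2) +
   (\sum_i \sum_j a i j * e j ^+ 2 - \sum_i \sum_j a i j * b i ^+ 2).
  rewrite mulr_sumr -sumrB -sumrN -big_split; apply: eq_bigr => i _ /=.
  rewrite mulrA mulr_sumr -sumrB -sumrN -big_split; apply: eq_bigr => j _ /=.
  by rewrite /e /b; ring.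
rewrite E gerDl subr_le0.
rewrite [leRHS](_ : _ = \sum_i \sum_j a i j * b j ^+ 2); last first.
  rewrite exchange_big; apply: eq_bigr => i _; apply: eq_bigr => j _.
  by rewrite aC.
by apply: ler_sum => i _; apply: ler_sum => j _; exact: ler_wpM2l.
Qed.

(** Along an edge the hypothesis holds in both orientations. If both endpoints are negative, each is
    within [eps] of 0; otherwise some orientation bounds their difference directly. *)
Lemma connected_spread (e : rel 'I_N) y (eps : R) : 0 <= eps ->
  (forall i j, e i j = e j i) -> graph_connected e ->
  (forall i j, e i j -> `|y i - Num.max (y j) 0| <= eps) ->
  forall i j, `|y i - y j| <= 2 * eps * N%:R.
Proof.
move=> e0 eC econ H i j.
have edge u v : e u v -> `|y u - y v| <= 2 * eps.
  move=> uv; have := H _ _ uv; rewrite eC in uv; have := H _ _ uv.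
  rewrite !ler_norml.
  by case: (leP 0 (y u)); case: (leP 0 (y v)) => ? ? /andP[? ?] /andP[? ?]; apply/andP; split; lra.
have /connectP[p ep ->] := econ i j.
(* A duplicate-free path has at most [N] vertices, which makes the bound uniform over all pairs. *)
have := shortenP ep => -[q eq uq _] {ep p}.
have sq : (size q <= N)%N.
  have := max_card (mem (i :: q)); rewrite card_ord (card_uniqP uq) /=; exact: ltnW.
have : `|y i - y (last i q)| <= 2 * eps * (size q)%:R.
  elim: q i eq {uq sq} => [|z q IH] u /=; first by rewrite subrr normr0 mulr0.
  move=> /andP[uz zq]; rewrite -[(size q).+1]addn1 natrD mulrDr mulr1 [leRHS]addrC.
  rewrite (le_trans (ler_distD (y z) _ _))// lerD//; [exact: edge|exact: IH].
move=> /le_trans; apply; rewrite ler_wpM2l ?ler_nat// mulr_ge0//.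
Qed.

(** * Consensus along a single trajectory *)

Section recurrent_consensus.
Variables (E : nat -> rel 'I_N) (L : nat) (al : nat -> R)
  (a : nat -> 'I_N -> 'I_N -> R) (a0 : R) (x : nat -> 'I_N -> R).
Hypothesis EC : forall k i j, E k i j = E k j i.
Hypothesis Econ : forall k, graph_connected (union_graph E k L).
Hypothesis al0 : forall k, 0 < al k.
Hypothesis al_decr : forall k, al k.+1 <= al k.
Hypothesis al_div : series al @ \oo --> +oo.
Hypothesis a0_gt0 : 0 < a0.
Hypothesis a_ge0 : forall k i j, 0 <= a k i j.
Hypothesis a_ge : forall k i j, E k i j -> a0 <= a k i j.

Let res k := \sum_i \sum_j a k i j * (x k i - Num.max (x k j) 0) ^+ 2.
Hypothesis res_sum : cvgn (series (fun k => al k * res k)).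
Hypothesis dx0 : forall i, (fun k => x k.+1 i - x k i) @ \oo --> (0 : R).

Let res_ge k i j : a k i j * (x k i - Num.max (x k j) 0) ^+ 2 <= res k.
Proof.
have p0 i' j' : 0 <= a k i' j' * (x k i' - Num.max (x k j') 0) ^+ 2.
  by rewrite mulr_ge0 ?sqr_ge0.
rewrite /res (bigD1 i)//= (bigD1 j)//= -addrA lerDl addr_ge0// sumr_ge0// => *.
by rewrite sumr_ge0.
Qed.

Let res_ge0 k : 0 <= res k.
Proof. by rewrite /res; apply: sumr_ge0 => i _; apply: sumr_ge0 => j _; rewrite mulr_ge0 ?sqr_ge0. Qed.

Let al_le k t : al (k + t)%N <= al k.
Proof.
elim: t => [|t IH]; first by rewrite addn0.
by rewrite addnS (le_trans (al_decr _)).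
Qed.

Let small_steps (eta : R) : 0 < eta ->
  exists K, forall k, (K <= k)%N -> forall i, `|x k.+1 i - x k i| <= eta.
Proof.
move=> eta0.
have : \forall k \near \oo, forall i, `|x k.+1 i - x k i| <= eta.
  apply: filter_forall => i.
  have /cvgrPdist_le := @dx0 i => /(_ _ eta0).
  by apply: filterS => k; rewrite sub0r normrN.
by move=> [K _ HK]; exists K => k Kk; exact: HK.
Qed.

(** Otherwise every late window contains an active edge with a large gap: an edge of the union graph
    is active at some time [k + t] of the window, and by then the states have hardly moved. Since
    the step sizes decrease, the window contributes at least [c * al (k + L)] to the sum of
    [al * res]; summing over windows contradicts the divergence of the series of [al]. *)
Lemma recurrent_small_residual (eps : R) (K : nat) : 0 < eps ->
  exists2 k, (K <= k)%N & forall i j, union_graph E k L i j ->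
    `|x k i - Num.max (x k j) 0| <= eps.
Proof.
move=> eps0; apply: contrapT => nH.
have H k : (K <= k)%N -> exists i j, union_graph E k L i j /\
    eps < `|x k i - Num.max (x k j) 0|.
  move=> Kk; apply: contrapT => nk; apply: nH; exists k => // i j ij.
  by rewrite leNgt; apply/negP => ?; apply: nk; exists i, j.
have LL : (0 : R) < 4 * L.+1%:R by rewrite mulr_gt0// ltr0n.
(* Over at most [L] steps each state moves by at most [eps / 4], so a gap above [eps] stays above
   [eps / 2]; this is the [eps / 2] in [c]. The successor keeps the denominator nonzero. *)
pose eta := eps / (4 * L.+1%:R).
have eta0 : 0 < eta by rewrite divr_gt0.
have [K' HK'] := small_steps eta0.
have drift k t i : (K' <= k)%N -> `|x (k + t)%N i - x k i| <= t%:R * eta.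
  move=> Kk; elim: t => [|t IH]; first by rewrite addn0 subrr normr0 mul0r.
  rewrite -[t.+1]addn1 natrD mulrDl mul1r addn1 addnS.
  rewrite [leRHS]addrC (le_trans (ler_distD (x (k + t)%N i) _ _))// lerD//.
  by apply: HK'; rewrite (leq_trans Kk)// leq_addr.
pose K2 := maxn K K'; pose c := a0 * (eps / 2) ^+ 2.
have c0 : 0 < c by rewrite mulr_gt0// exprn_gt0// divr_gt0.
have big k : (K2 <= k)%N ->
    c * al (k + L)%N <= \sum_(t < L) al (k + t)%N * res (k + t)%N.
  rewrite geq_max => /andP[Kk K'k].
  have [i [j [/existsP[t tij] rij]]] := H k Kk.
  rewrite (bigD1 t)//= ler_wpDr//.
    by apply: sumr_ge0 => s _; rewrite mulr_ge0// ltW.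
  rewrite mulrC ler_pM//; [exact: ltW|exact: ltW| |].
    by have := al_le (k + t)%N (L - t)%N; rewrite -addnA subnKC// ltnW.
  apply: le_trans (res_ge (k + t)%N i j).
  rewrite /c ler_pM ?sqr_ge0 ?(ltW a0_gt0) ?a_ge//.
  rewrite -[leRHS]real_normK ?num_real// ler_sqr ?nnegrE ?divr_ge0 ?(ltW eps0)//.
  have te : t%:R * eta <= eps / 4.
    have -> : eps / 4 = L.+1%:R * eta.
      rewrite /eta; have : (L.+1%:R : R) != 0 by rewrite pnatr_eq0.
      by move: (L.+1%:R : R) => l l0; field.
    by rewrite ler_wpM2r ?(ltW eta0)// ler_nat ltnW// ltnS ltnW.
  have := drift k t i K'k; have := drift k t j K'k; move: rij te.
  move: (x k i) (x k j) (x (k + t)%N i) (x (k + t)%N j) (t%:R * eta) => p q p' q' r.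
  rewrite !ler_norml ltr_normr => + re /andP[? ?] /andP[? ?].
  case: (leP 0 q); case: (leP 0 q') => ? ? /orP[] ?; rewrite ler_normr; apply/orP;
    solve [left; lra | right; lra].
pose b k := al k * res k; pose B := limn (series b).
have b0 k : 0 <= b k by rewrite mulr_ge0// ltW.
have bB n : series b n <= B by exact: series_le_limn.
(* Each index lies in at most [L] windows, whence the factor [L]. *)
have bound n : c * \sum_(k < n) al (K2 + k + L)%N <= L%:R * B.
  rewrite mulr_sumr; apply: (@le_trans _ _ (\sum_(k < n) \sum_(t < L) b (K2 + k + t)%N)).
    by apply: ler_sum => k _; apply: big; exact: leq_addr.
  rewrite exchange_big -[X in X%:R * _]card_ord mulr_natl -sumr_const.
  apply: ler_sum => t _.
  apply: le_trans (bB (K2 + t + n)%N).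
  rewrite [(_ + n)%N]addnC series_shift.
  rewrite -[leLHS]add0r lerD//; first by rewrite /series/= sumr_ge0.
  rewrite le_eqVlt; apply/orP; left; apply/eqP; apply: eq_bigr => k _.
  by congr b; rewrite addnAC addnC.
have /cvgryPgt/(_ (series al (K2 + L)%N + L%:R * B / c)) [n _ Hn] := al_div.
have := Hn (n + (K2 + L))%N (leq_addr _ _).
rewrite /= (series_shift _ n (K2 + L)%N) ltrD2l ltNge => /negP; apply.
rewrite ler_pdivlMr// mulrC.
apply: le_trans (bound n).
rewrite ler_pM2l//.
rewrite le_eqVlt; apply/orP; left; apply/eqP; apply: eq_bigr => k _.
by congr al; rewrite addnC addnAC.
Qed.

Hypothesis Sx : cvgn (fun k => \sum_i x k i).
Hypothesis Qx : cvgn (fun k => \sum_i x k i ^+ 2).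

(** The sum and the sum of squares determine the mean [m] and the dispersion [V] around it, so both
    converge. It remains to see that [V] takes small values at arbitrarily late times. *)
Lemma consensus : exists l : R, forall i, (fun k => x k i) @ \oo --> l.
Proof.
have [N0|N0] := posnP N.
  by exists 0 => -[i iN]; exfalso; move: iN; rewrite N0.
have Nr : (0 : R) < N%:R by rewrite ltr0n.
pose m k := (\sum_i x k i) / N%:R.
have cm : cvgn m by apply: is_cvgM => //; exact: is_cvg_cst.
pose V k := \sum_i (x k i - m k) ^+ 2.
have VE k : V k = \sum_i x k i ^+ 2 - N%:R * m k * m k.
  have E1 : \sum_i x k i = N%:R * m k by rewrite /m mulrCA mulfV ?mulr1// gt_eqF.
  rewrite /V (eq_bigr (fun i => x k i ^+ 2 + (- 2 * m k * x k i + m k ^+ 2))); last first.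
    by move=> i _; ring.
  rewrite !big_split /= -mulr_sumr E1 sumr_const card_ord -mulr_natl.
  by ring.
have cV : cvgn V.
  rewrite (_ : V = (fun k => \sum_i x k i ^+ 2 - N%:R * m k * m k)); last exact/funext.
  apply: is_cvgB => //; apply: is_cvgM => //; apply: is_cvgM => //; exact: is_cvg_cst.
have V0 k : 0 <= V k by apply: sumr_ge0 => i _; exact: sqr_ge0.
have Vi k i : (x k i - m k) ^+ 2 <= V k.
  by rewrite /V (bigD1 i)//= lerDl sumr_ge0// => *; exact: sqr_ge0.
have V00 : limn V = 0.
  apply/eqP; rewrite eq_le; apply/andP; split; last by apply: limr_ge => //; exact: nearW.
  rewrite leNgt; apply/negP => v0.
  (* [eps] solves [N * (2 * eps * N)^2 = lim V / 2]: a spread of at most [2 * eps * N] forces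
     [V k <= lim V / 2], whereas [V] eventually exceeds [lim V / 2]. *)
  pose C : R := N%:R * (2 * N%:R) ^+ 2.
  have C0 : 0 < C by rewrite mulr_gt0// exprn_gt0// mulr_gt0.
  pose eps := Num.sqrt (limn V / 2 / C).
  have eps0 : 0 < eps by rewrite sqrtr_gt0 !divr_gt0.
  have vv : limn V / 2 < limn V by rewrite ltr_pdivrMr// ltr_pMr// ltr1n.
  have [K _ HK] := @cvgr_gt _ _ _ _ _ _ cV _ vv.
  have [k Kk Hk] := recurrent_small_residual K eps0.
  have UC i j : union_graph E k L i j = union_graph E k L j i.
    by rewrite /union_graph; under eq_existsb do rewrite EC.
  have spread := connected_spread (ltW eps0) UC (@Econ k) Hk.
  have := HK k Kk; rewrite /= ltNge => /negP; apply.
  have -> : limn V / 2 = N%:R * (2 * eps * N%:R) ^+ 2.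
    have -> : N%:R * (2 * eps * N%:R) ^+ 2 = C * eps ^+ 2 by rewrite /C; ring.
    rewrite sqr_sqrtr; first by rewrite mulrCA mulfV ?mulr1// gt_eqF.
    by rewrite ltW// !divr_gt0.
  rewrite mulr_natl -[X in _ *+ X]card_ord -sumr_const; apply: ler_sum => i _.
  rewrite -real_normK ?num_real// ler_sqr ?nnegrE ?mulr_ge0 ?(ltW eps0)//.
  have -> : x k i - m k = (\sum_j (x k i - x k j)) / N%:R.
    by rewrite sumrB sumr_const card_ord -[x k i *+ N]mulr_natr mulrBl mulfK ?gt_eqF.
  have NV : 0 <= N%:R^-1 :> R by rewrite invr_ge0 ltW.
  rewrite normrM (ger0_norm NV) ler_pdivrMr//.
  have -> : 2 * eps * N%:R * N%:R = \sum_(j < N) 2 * eps * N%:R.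
    by rewrite sumr_const card_ord -[RHS]mulr_natr.
  by apply: le_trans (ler_norm_sum _ _ _) _; apply: ler_sum.
exists (limn m) => i.
rewrite (_ : (fun k => x k i) = (fun k => (x k i - m k) + m k)); last first.
  by apply/funext => k; rewrite subrK.
rewrite -[X in _ --> X]add0r; apply: cvgD; last exact: cm.
have sV : (fun k => Num.sqrt (V k)) @ \oo --> (0 : R).
  rewrite -(sqrtr0 R) -V00; apply: continuous_cvg => //; exact: sqrt_continuous.
apply/norm_cvg0P; apply: squeeze_cvgr sV; last exact: cvg_cst.
apply: nearW => k; rewrite normr_ge0/= -(sqrtr_sqr (x k i - m k)).
by rewrite ler_sqrt.
Qed.

End recurrent_consensus.
End deterministic.

(** * Linear forms in independent variables *)

Section gronwall.
Context {R : realType}.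

(** One step multiplies [1 + v] by at most [1 + C * al2 k <= exp (C * al2 k)], which bounds [v]. The
    error terms are then summable, and telescoping bounds the sum of [r]. *)
Lemma discrete_gronwall (v r al2 : nat -> R) (C : R) : 0 <= C ->
  (forall k, 0 <= v k) -> (forall k, 0 <= r k) -> (forall k, 0 <= al2 k) ->
  (forall k, v k.+1 + r k <= v k + C * al2 k * (1 + v k)) ->
  cvgn (series al2) ->
  exists M, forall n, v n <= M /\ \sum_(k < n) r k <= M.
Proof.
move=> C0 v0 r0 a0 H ca.
pose B := limn (series al2).
have aB n : series al2 n <= B by exact: series_le_limn.
pose M0 := expR (C * B) * (1 + v 0%N).
have vM n : 1 + v n <= M0.
  apply: (@le_trans _ _ (expR (C * series al2 n) * (1 + v 0%N))); last first.
    by rewrite ler_wpM2r ?addr_ge0// ler_expR ler_wpM2l.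
  elim: n => [|n IH]; first by rewrite /series/= big_geq// mulr0 expR0 mul1r.
  rewrite /series/= big_nat_recr//= (mulrDr C) expRD mulrAC.
  apply: (@le_trans _ _ ((1 + v n) * expR (C * al2 n))); last first.
    by rewrite ler_wpM2r ?expR_ge0.
  apply: (@le_trans _ _ ((1 + v n) * (1 + C * al2 n))).
    by have := H n; have := r0 n; move: (C * al2 n) => c; nra.
  by rewrite ler_wpM2l ?addr_ge0// expR_ge1Dx.
have M00 : 0 <= M0 by rewrite mulr_ge0 ?expR_ge0// addr_ge0.
have B0 : 0 <= B by have := aB 0%N; rewrite /series/= big_geq.
have rn n : v n + \sum_(k < n) r k <= v 0%N + C * M0 * series al2 n.
  elim: n => [|n IH]; first by rewrite big_ord0 /series/= big_geq// mulr0 !addr0.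
  rewrite big_ord_recr /series/= big_nat_recr//= mulrDr.
  have : C * al2 n * (1 + v n) <= C * M0 * al2 n.
    by rewrite (mulrAC C M0) ler_wpM2l ?mulr_ge0.
  have := H n; move: IH; rewrite /series/=.
  by move: (\sum_(k < n) _) (\sum_(0 <= k < n) _) => *; lra.
exists (M0 + v 0%N + C * M0 * B) => n; split.
  have := vM n; have := v0 0%N; have : 0 <= C * M0 * B by exact: mulr_ge0 (mulr_ge0 C0 M00) B0.
  by lra.
have : C * M0 * series al2 n <= C * M0 * B by rewrite ler_wpM2l// mulr_ge0.
by have := rn n; have := v0 n; lra.
Qed.

Lemma sqr_sum_le (K : finType) (f : K -> R) :
  (\sum_t f t) ^+ 2 <= #|K|%:R * \sum_t f t ^+ 2.
Proof.
rewrite expr2 mulr_suml.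
under eq_bigr do rewrite mulr_sumr.
apply: (@le_trans _ _ (\sum_s \sum_t ((f s ^+ 2 + f t ^+ 2) / 2))).
  apply: ler_sum => s _; apply: ler_sum => t _.
  by have := sqr_ge0 (f s - f t); move: (f s) (f t) => x y; nra.
under eq_bigr do rewrite -mulr_suml big_split/= sumr_const.
rewrite -mulr_suml big_split/= sumr_const.
rewrite sumrMnl; move: (\sum__ _) => s; rewrite -[s *+ _]mulr_natl.
by move: (_%:R : R) => n; have -> : (n * s + n * s) / 2 = n * s by field.
Qed.

Lemma exp4_sum_le (K : finType) (f : K -> R) :
  (\sum_t f t) ^+ 4 <= #|K|%:R ^+ 3 * \sum_t f t ^+ 4.
Proof.
rewrite [_ ^+ 4](exprM _ 2 2).
have H := sqr_sum_le f.
have s0 : 0 <= \sum_t f t ^+ 2 by apply: sumr_ge0 => t _; exact: sqr_ge0.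
apply: (@le_trans _ _ ((#|K|%:R * \sum_t f t ^+ 2) ^+ 2)).
  by rewrite ler_sqr ?nnegrE ?sqr_ge0// mulr_ge0.
rewrite exprMn (exprSr _ 2) -mulrA ler_wpM2l ?sqr_ge0//.
by under [in leRHS]eq_bigr do rewrite (exprM _ 2 2); exact: sqr_sum_le.
Qed.

Lemma finite_pos_lower_bound (K : finType) (f : K -> R) : (forall t, 0 < f t) ->
  exists2 c, 0 < c & forall t, c <= f t.
Proof.
move=> f0; have S0 : 0 <= \sum_t (f t)^-1 by apply: sumr_ge0 => t _; rewrite invr_ge0 ltW.
(* An explicit lower bound instead of the minimum, meaningful for an empty [K] too. *)
exists (1 + \sum_t (f t)^-1)^-1; first by rewrite invr_gt0 ltr_wpDr.
move=> t; rewrite -[leRHS]invrK lef_pV2 ?posrE ?invr_gt0// ?ltr_wpDr//.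
rewrite (bigD1 t)//= addrCA lerDl addr_ge0// sumr_ge0// => s _.
by rewrite invr_ge0 ltW.
Qed.

End gronwall.

(** * Moments of linear forms in fresh variables with past-dependent coefficients *)

Section linear_form.
Context d (T : measurableType d) (R : realType) (P : probability T R)
  (I : eqType) (Z : I -> T -> R).
Hypothesis mZ : forall i, measurable_fun setT (Z i).
Hypothesis indepZ : mutually_independent P Z.
Variables (J : set I) (K : finType) (tau : K -> I) (C : K -> T -> R).
Hypothesis tau_inj : injective tau.
Hypothesis tauJ : forall t, ~ J (tau t).
Hypothesis mC : forall t, cyl_measurable Z J (C t).
Hypothesis LC : forall t, sqintg P (fun w => C t w ^+ 2).
Hypothesis LZ : forall t, sqintg P (fun w => Z (tau t) w ^+ 2).

Let Y w := \sum_t C t w * Z (tau t) w.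

Let sqintg_prod (U V : T -> R) : measurable_fun setT U -> measurable_fun setT V ->
  sqintg P (fun w => U w ^+ 2) -> sqintg P (fun w => V w ^+ 2) ->
  sqintg P (fun w => U w * V w).
Proof.
move=> mU mV LU LV; apply: le_sqintg (sqintgD LU LV); first exact: measurable_funM.
move=> w; rewrite [leRHS]ger0_norm ?addr_ge0 ?sqr_ge0//.
rewrite ler_norml; have := sqr_ge0 (U w); have := sqr_ge0 (V w).
have := sqr_ge0 (U w - V w); have := sqr_ge0 (U w + V w).
by move: (U w) (V w) => x y *; apply/andP; split; nra.
Qed.

Let mCT t : measurable_fun setT (C t).
Proof. exact: cyl_measurableW. Qed.

Let sqintg_coord t : sqintg P (Z (tau t)).
Proof.
split => //; exact: sqintg_intg (LZ t).
Qed.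

(** The power-mean inequality reduces to single products, whose fourth moments factor since [tau t]
    lies outside [J]. Square integrability of a square encodes a finite fourth moment. *)
Lemma sqintg_sqr_linear_form : sqintg P (fun w => Y w ^+ 2) /\
  \int[P]_w (Y w ^+ 4) <=
  #|K|%:R ^+ 3 * \sum_t (\int[P]_w (C t w ^+ 4)) * (\int[P]_w (Z (tau t) w ^+ 4)).
Proof.
have mY : measurable_fun setT Y.
  by apply: measurable_sum => t; exact: measurable_funM.
have E4 (x : R) : x ^+ 4 = (x ^+ 2) ^+ 2 by rewrite -exprM.
have pull t := @indep_pull _ _ _ P _ Z mZ indepZ J (tau t) (fun w => C t w ^+ 4) (fun x => x ^+ 4).
have IC t : intg P (fun w => C t w ^+ 4).
  by under eq_fun do rewrite E4; exact: (LC t).2.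
have IZ t : intg P (fun w => Z (tau t) w ^+ 4).
  by under eq_fun do rewrite E4; exact: (LZ t).2.
have {}pull t : intg P (fun w => (C t w * Z (tau t) w) ^+ 4) /\
   \int[P]_w ((C t w * Z (tau t) w) ^+ 4) =
   (\int[P]_w (C t w ^+ 4)) * (\int[P]_w (Z (tau t) w ^+ 4)).
  have [] := pull t (tauJ (t:=t)).
  - exact: measurable_funX (mC t).
  - exact: exprn_measurable.
  - exact: IC.
  - exact: IZ.
  by move=> I1 E1; split; [under eq_fun do rewrite exprMn|under eq_Rintegral do rewrite exprMn].
have IS : intg P (fun w => #|K|%:R ^+ 3 * \sum_t (C t w * Z (tau t) w) ^+ 4).
  by apply: intgZ; apply: intg_sum => t _; exact: (pull t).1.
have Y4 w : Y w ^+ 4 <= #|K|%:R ^+ 3 * \sum_t (C t w * Z (tau t) w) ^+ 4.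
  exact: exp4_sum_le.
have IY4 : intg P (fun w => Y w ^+ 4).
  apply: le_intg IS; first exact: measurable_funX.
  by move=> w; rewrite ger0_norm// exprn_even_ge0.
split.
  split; first exact: measurable_funX.
  by under eq_fun do rewrite -E4.
apply: le_trans (le_Rintegral measurableT IY4 IS (fun w _ => Y4 w)) _.
rewrite RintegralZl//; last by apply: intg_sum => t _; exact: (pull t).1.
rewrite Rintegral_sum => [|t _]; last exact: (pull t).1.
by under eq_bigr do rewrite (pull _).2.
Qed.

(** The conditional second moment given [J], in weak form with test function [G]: centered
    independent variables leave only the diagonal terms. *)
Lemma integral_sqr_linear_form (G : T -> R) (v : K -> R) :
  cyl_measurable Z J G -> sqintg P G ->
  (forall t, \int[P]_w Z (tau t) w = 0) ->
  (forall t, \int[P]_w (Z (tau t) w ^+ 2) = v t) ->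
  \int[P]_w (G w * Y w ^+ 2) = \sum_t v t * \int[P]_w (G w * C t w ^+ 2).
Proof.
move=> mG LG Z0 Z2.
have IGC s t : intg P (fun w => G w * (C s w * C t w)).
  by apply: sqintgM => //; exact: sqintg_prod.
have mGC s t : cyl_measurable Z J (fun w => G w * (C s w * C t w)).
  by apply: measurable_funM; [exact: mG|apply: measurable_funM; exact: mC].
have IZ t : intg P (Z (tau t)) := sqintg_intg (sqintg_coord t).
have diag t : intg P (fun w => G w * (C t w * C t w) * Z (tau t) w ^+ 2) /\
    \int[P]_w (G w * (C t w * C t w) * Z (tau t) w ^+ 2) =
    v t * \int[P]_w (G w * C t w ^+ 2).
  have [] := @indep_pull _ _ _ P _ Z mZ indepZ J (tau t) _ (fun x => x ^+ 2)
    (@tauJ t) (mGC t t) (@exprn_measurable _ _ _) (IGC t t) (sqintg_coord t).2.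
  by move=> ? E; split => //; rewrite E Z2 mulrC.
have offdiag s t : s != t ->
    intg P (fun w => G w * (C s w * C t w) * Z (tau s) w * Z (tau t) w) /\
    \int[P]_w (G w * (C s w * C t w) * Z (tau s) w * Z (tau t) w) = 0.
  move=> st.
  have [I1 _] := indep_pull0 mZ indepZ (@tauJ s) (mGC s t) (IGC s t) (IZ s) (Z0 s).
  (* Pulling out the second variable requires [tau s] among the known ones; [tau t] is still fresh
     because [tau] is injective. *)
  apply: (indep_pull0 mZ indepZ (J := J `|` [set tau s])) => //.
  - by move=> [/tauJ//|/= /tau_inj ts]; rewrite ts eqxx in st.
  - apply: measurable_funM; first exact: (cyl_measurableS (@subsetUl _ _ _) (mGC s t)).
    by apply: cyl_measurable_coord; right.
have term s t w : G w * (C s w * Z (tau s) w * (C t w * Z (tau t) w)) =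
    if s == t then G w * (C t w * C t w) * Z (tau t) w ^+ 2
    else G w * (C s w * C t w) * Z (tau s) w * Z (tau t) w.
  by case: eqP => [->|_]; ring.
have Iterm s t : intg P (fun w => G w * (C s w * Z (tau s) w * (C t w * Z (tau t) w))).
  under eq_fun do rewrite term.
  by case: (eqVneq s t) => [_|/offdiag[]//]; have [] := diag t.
under eq_Rintegral => w _.
  rewrite expr2 /Y mulr_suml mulr_sumr.
  under eq_bigr do rewrite mulr_sumr mulr_sumr.
  over.
rewrite Rintegral_sum => [|s _]; last by apply: intg_sum.
apply: eq_bigr => s _; rewrite Rintegral_sum//.
rewrite (bigD1 s)//= big1 => [|t ts].
  by under eq_Rintegral do rewrite term eqxx; rewrite addr0 (diag s).2.
rewrite eq_sym in ts.
by under eq_Rintegral do rewrite term (negbTE ts); rewrite (offdiag s t ts).2.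
Qed.

End linear_form.

(** * The protocol *)

Section protocol.
Context (R : realType) (d : measure_display) (T : measurableType d)
  (P : probability T R) (N : nat)
  (E : nat -> rel 'I_N) (failed : nat -> pred 'I_N)
  (x0 : 'I_N -> R) (rho ure uim : R)
  (p : 'I_N -> R) (Lam : 'I_N -> 'I_N -> R) (s2 : 'I_N -> R)
  (alpha : nat -> R)
  (gam : 'I_N -> nat -> T -> R) (hre him : 'I_N -> 'I_N -> nat -> T -> R)
  (nre nim : 'I_N -> nat -> T -> R).
Hypothesis EC : forall k i j, E k i j = E k j i.
Hypothesis Eirr : forall k i, ~~ E k i i.
Hypothesis Efail : forall k i j, failed k i -> ~~ E k i j.
Hypothesis rho0 : 0 < rho.
Hypothesis u1 : ure ^+ 2 + uim ^+ 2 = 1.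
Hypothesis p01 : forall i, 0 < p i < 1.
Hypothesis LamC : forall i j, Lam i j = Lam j i.
Hypothesis Lam0 : forall i j, 0 < Lam i j.
Hypothesis s20 : forall i, 0 <= s2 i.
Hypothesis mZ : forall a, measurable_fun setT (all_rvs gam hre him nre nim a).
Hypothesis gam01 : forall i k w, gam i k w = 0 \/ gam i k w = 1.
Hypothesis Pgam : forall i k, P (gam i k @^-1` [set 1]) = (p i)%:E.
Hypothesis gauss_h : forall i j k, complex_gaussian_parts P (hre i j k) (him i j k) (Lam i j).
Hypothesis gauss_n : forall i k, complex_gaussian_parts P (nre i k) (nim i k) (s2 i).
Hypothesis indepZ : mutually_independent P (all_rvs gam hre him nre nim).

Notation Z := (all_rvs gam hre him nre nim).
Notation x := (xstate E failed x0 alpha rho ure uim p Lam s2 gam hre him nre nim).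
Notation yr k i := (y_re E rho ure uim gam hre him nre (x k) k i).
Notation yi k i := (y_im E rho ure uim gam hre him nim (x k) k i).
Notation pos r := (Num.max r 0).

Definition idx_gam (i : 'I_N) (k : nat) : rv_index N := inl (inl (inl (inl (i, k)))).
Definition idx_hre (i j : 'I_N) (k : nat) : rv_index N := inl (inl (inl (inr (i, j, k)))).
Definition idx_him (i j : 'I_N) (k : nat) : rv_index N := inl (inl (inr (i, j, k))).
Definition idx_nre (i : 'I_N) (k : nat) : rv_index N := inl (inr (i, k)).
Definition idx_nim (i : 'I_N) (k : nat) : rv_index N := inr (i, k).

Definition rv_time (a : rv_index N) : nat :=
  match a with
  | inl (inl (inl (inl (_, k)))) => k
  | inl (inl (inl (inr (_, _, k)))) => k
  | inl (inl (inr (_, _, k))) => k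
  | inl (inr (_, k)) => k
  | inr (_, k) => k
  end.

(** The inequality is strict because [x k] depends only on draws made before time [k]. *)
Definition past k : set (rv_index N) := [set a | (rv_time a < k)%N].
(** With the activation bits of time [k] added to the past, the received signals become linear forms
    in fresh Gaussians with known coefficients. *)
Definition gpast k : set (rv_index N) := past k `|` [set a | exists i, a = idx_gam i k].

Lemma pastS k : past k `<=` past k.+1.
Proof. by move=> a; rewrite /past /= => /ltnW; rewrite ltnS. Qed.

Definition coef k i j w := Gamma gam i j k w * Num.sqrt (rho * x k j w).

Lemma cyl_measurable_gam J i k : J (idx_gam i k) -> cyl_measurable Z J (gam i k).
Proof. exact: (@cyl_measurable_coord _ _ _ _ Z J (idx_gam i k)). Qed.

Lemma cyl_measurable_Gamma J i j k : J (idx_gam i k) -> J (idx_gam j k) ->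
  cyl_measurable Z J (Gamma gam i j k).
Proof.
move=> /cyl_measurable_gam mi /cyl_measurable_gam mj.
by apply: measurable_funD; apply: measurable_funM => //; apply: measurable_funB.
Qed.

Lemma cyl_measurable_sqrt J (f : T -> R) :
  cyl_measurable Z J f -> cyl_measurable Z J (fun w => Num.sqrt (f w)).
Proof.
move=> mf.
have ms : measurable_fun [set: R] (Num.sqrt : R -> R).
  by apply: continuous_measurable_fun; exact: sqrt_continuous.
exact: (measurableT_comp ms mf).
Qed.

Lemma cyl_measurable_coef k i j J : past k `<=` J -> J (idx_gam i k) -> J (idx_gam j k) ->
  cyl_measurable Z (past k) (x k j) -> cyl_measurable Z J (coef k i j).
Proof.
move=> kJ Ji Jj mx; apply: measurable_funM; first exact: cyl_measurable_Gamma.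
apply: cyl_measurable_sqrt; apply: measurable_funM => //.
exact: cyl_measurableS mx.
Qed.

Lemma cyl_measurable_state k i : cyl_measurable Z (past k) (x k i).
Proof.
elim: k i => [|k IH] i; first exact: measurable_cst.
have mS f : cyl_measurable Z (past k) f -> cyl_measurable Z (past k.+1) f.
  by apply: cyl_measurableS; exact: pastS.
have mc a : rv_time a = k -> cyl_measurable Z (past k.+1) (Z a).
  by move=> ak; apply: cyl_measurable_coord; rewrite /past /= ak.
have mcoef j : cyl_measurable Z (past k.+1) (coef k i j).
  by apply: cyl_measurable_coef; [exact: pastS|rewrite /past /=|rewrite /past /=|exact: IH].
rewrite /=; case: (failed k i); first exact: mS.
apply: measurable_funD.
  by apply: measurable_funM => //; exact: mS.
apply: measurable_funM => //; apply: measurable_funB => //.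
apply: measurable_funD; apply: measurable_funX; apply: measurable_funD.
- under eq_fun do rewrite big_mkcond.
  apply: measurable_sum => j; case: (E k i j) => //.
  apply: measurable_funM; first exact: mcoef.
  apply: measurable_funB; apply: measurable_funM => //.
    exact: (mc (idx_hre i j k)).
  exact: (mc (idx_him i j k)).
- exact: (mc (idx_nre i k)).
- under eq_fun do rewrite big_mkcond.
  apply: measurable_sum => j; case: (E k i j) => //.
  apply: measurable_funM; first exact: mcoef.
  apply: measurable_funD; apply: measurable_funM => //.
    exact: (mc (idx_hre i j k)).
  exact: (mc (idx_him i j k)).
- exact: (mc (idx_nim i k)).
Qed.

Lemma measurable_state k i : measurable_fun setT (x k i).
Proof. exact: (cyl_measurableW mZ (@cyl_measurable_state k i)). Qed.

Lemma cyl_measurable_pos J (f : T -> R) :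
  cyl_measurable Z J f -> cyl_measurable Z J (fun w => pos (f w)).
Proof. by move=> mf; apply: measurable_maxr => //; exact: measurable_cst. Qed.

(** Since a bit equals its square, the result is multilinear in the bits, and independence applies
    monomial by monomial. *)
Lemma Gamma_sqr i j k w : Gamma gam i j k w ^+ 2 =
  gam i k w + gam j k w - 2 * (gam i k w * gam j k w).
Proof.
rewrite /Gamma.
by case: (gam01 i k w) => ->; case: (gam01 j k w) => ->; ring.
Qed.

Lemma sqr_coef k i j w : coef k i j w ^+ 2 = Gamma gam i j k w ^+ 2 * (rho * pos (x k j w)).
Proof.
rewrite /coef exprMn; congr (_ * _).
case: (leP 0 (x k j w)) => x0'.
  by rewrite sqr_sqrtr// mulr_ge0// ltW.
by rewrite ler0_sqrtr ?expr0n ?mulr0// nmulr_lle0// ltW.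
Qed.

(** The square of an amplitude is linear in the state, so fourth moments of the coefficients need
    only second moments of the states. *)
Lemma sqr_coef_le k i j w : coef k i j w ^+ 2 <= rho * `|x k j w|.
Proof.
rewrite sqr_coef.
have G1 : Gamma gam i j k w ^+ 2 <= 1.
  by rewrite Gamma_sqr; case: (gam01 i k w) => ->; case: (gam01 j k w) => ->; lra.
apply: (@le_trans _ _ (rho * pos (x k j w))).
  by rewrite ler_piMl// mulr_ge0 ?(ltW rho0)// le_max lexx orbT.
rewrite ler_pM2l// ge_max ler_norm normr_ge0//.
Qed.

Lemma intg_gam i k : intg P (gam i k).
Proof.
apply: le_intg (intg_cst P 1); first exact: (mZ (idx_gam i k)).
by move=> w /=; case: (gam01 i k w) => ->; rewrite ?normr0 ?normr1.
Qed.

Lemma mean_gam i k : \int[P]_w gam i k w = p i.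
Proof.
have mA : measurable (gam i k @^-1` [set 1]).
  by rewrite -[X in measurable X]setTI; exact: (mZ (idx_gam i k)).
rewrite /Rintegral (eq_integral (fun w => (\1_(gam i k @^-1` [set 1]) w)%:E)).
  by rewrite integral_indic// setIT; exact: congr1 (Pgam i k).
move=> w _; congr EFin; rewrite indicE.
have -> : (w \in gam i k @^-1` [set 1]) = (gam i k w == 1).
  by apply/idP/eqP; rewrite inE.
by case: (gam01 i k w) => ->; rewrite ?eqxx// eq_sym oner_eq0.
Qed.

Lemma pastN_gam i k : ~ past k (idx_gam i k).
Proof. by rewrite /past /= ltnn. Qed.

(** Source of the probability factor in [abar]: the bits of two distinct agents are pulled out one
    after the other. *)
Lemma integral_Gamma_sqr k i j (W : T -> R) : i != j ->
  cyl_measurable Z (past k) W -> intg P W ->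
  \int[P]_w (W w * Gamma gam i j k w ^+ 2) =
  (p i * (1 - p j) + p j * (1 - p i)) * \int[P]_w W w.
Proof.
move=> ij mW iW.
have pull J l V : ~ J (idx_gam l k) -> cyl_measurable Z J V -> intg P V ->
    intg P (fun w => V w * gam l k w) /\
    \int[P]_w (V w * gam l k w) = p l * \int[P]_w V w.
  move=> Jl mV iV; rewrite -(mean_gam l k) mulrC.
  exact: (@indep_pull _ _ _ P _ Z mZ indepZ J (idx_gam l k) V idfun Jl mV
    (@measurable_id _ _ _) iV (intg_gam l k)).
have [Ii Ei] := pull _ i W (@pastN_gam i k) mW iW.
have [Ij Ej] := pull _ j W (@pastN_gam j k) mW iW.
have [Iij Eij] : intg P (fun w => W w * gam i k w * gam j k w) /\
    \int[P]_w (W w * gam i k w * gam j k w) = p j * (p i * \int[P]_w W w).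
  rewrite -Ei; apply: (pull (past k `|` [set idx_gam i k])) => //.
    by move=> [/pastN_gam//|/= [ji]]; rewrite ji eqxx in ij.
  apply: measurable_funM; first by apply: (cyl_measurableS _ mW); exact: subsetUl.
  by apply: cyl_measurable_gam; right.
rewrite (@eq_Rintegral _ _ _ P setT (fun w => (W w * gam i k w + W w * gam j k w)
   - 2 * (W w * gam i k w * gam j k w))); last first.
  by move=> w _; rewrite Gamma_sqr; ring.
rewrite RintegralB//; [|exact: intgD|exact: intgZ].
by rewrite RintegralD// RintegralZl// Ei Ej Eij; ring.
Qed.

Lemma gaussian_moments (X : T -> R) (v : R) : measurable_fun setT X -> 0 <= v ->
  centered_gaussian P X v ->
  [/\ sqintg P (fun w => X w ^+ 2), \int[P]_w X w = 0, \int[P]_w (X w ^+ 2) = v &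
      \int[P]_w (X w ^+ 4) = 3 * v ^+ 2].
Proof.
move=> mX v0 gX; split.
- split; first exact: measurable_funX.
  apply: ge0_intg => [|w|].
  + by do 2 apply: measurable_funX.
  + exact: sqr_ge0.
  + under eq_integral do rewrite -exprM.
    by rewrite (gaussian_moment4 v0 mX gX) ltry.
- exact: gaussian_mean v0 mX gX.
- by rewrite /Rintegral (gaussian_moment2 v0 mX gX).
- by rewrite /Rintegral (gaussian_moment4 v0 mX gX).
Qed.

(* Real and imaginary parts of y_i(k) as linear forms in the Gaussians drawn at
   time k: (a, b) = (ure, -uim) gives the real part, (uim, ure) the imaginary. *)
Definition term : finType := ('I_N + 'I_N + 'I_1)%type.

Definition term_idx (im : bool) k i (t : term) : rv_index N :=
  match t with
  | inl (inl j) => idx_hre i j k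
  | inl (inr j) => idx_him i j k
  | inr _ => if im then idx_nim i k else idx_nre i k
  end.

Definition term_coef (a b : R) k i (t : term) (w : T) : R :=
  match t with
  | inl (inl j) => if E k i j then a * coef k i j w else 0
  | inl (inr j) => if E k i j then b * coef k i j w else 0
  | inr _ => 1
  end.

Definition term_var i (t : term) : R :=
  match t with
  | inl (inl j) => Lam i j / 2
  | inl (inr j) => Lam i j / 2
  | inr _ => s2 i / 2
  end.

Lemma y_reE k i w :
  yr k i w = \sum_t term_coef ure (- uim) k i t w * Z (term_idx false k i t) w.
Proof.
rewrite !big_sumType big_ord1 /= mul1r -big_split /=; congr (_ + _).
rewrite big_mkcond; apply: eq_bigr => j _ /=.
by case: ifP => _; rewrite /coef; ring.
Qed.

Lemma y_imE k i w :
  yi k i w = \sum_t term_coef uim ure k i t w * Z (term_idx true k i t) w.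
Proof.
rewrite !big_sumType big_ord1 /= mul1r -big_split /=; congr (_ + _).
rewrite big_mkcond; apply: eq_bigr => j _ /=.
by case: ifP => _; rewrite /coef; ring.
Qed.

Lemma term_idx_inj im k i : injective (term_idx im k i).
Proof.
by move=> [[j|j]|j] [[l|l]|l] //=; try (by case: im); try (by case=> ->);
  move=> _; rewrite !ord1.
Qed.

Lemma term_idx_fresh im k i t : ~ gpast k (term_idx im k i t).
Proof.
by case: t => [[j|j]|j] /=; try case: im => /=;
  move=> [|[l]//]; rewrite /past /= ltnn.
Qed.

Lemma term_var_ge0 i t : 0 <= term_var i t.
Proof. by case: t => [[j|j]|j] /=; rewrite divr_ge0// ltW. Qed.

Lemma term_moments im k i t :
  [/\ sqintg P (fun w => Z (term_idx im k i t) w ^+ 2),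
      \int[P]_w Z (term_idx im k i t) w = 0,
      \int[P]_w (Z (term_idx im k i t) w ^+ 2) = term_var i t &
      \int[P]_w (Z (term_idx im k i t) w ^+ 4) = 3 * term_var i t ^+ 2].
Proof.
apply: gaussian_moments; [exact: mZ|exact: term_var_ge0|].
case: t => [[j|j]|j] /=.
- exact: (gauss_h i j k).1.
- exact: (gauss_h i j k).2.
- by case: im; [exact: (gauss_n i k).2|exact: (gauss_n i k).1].
Qed.

Lemma cyl_measurable_term_coef a b k i t :
  cyl_measurable Z (gpast k) (term_coef a b k i t).
Proof.
have mc j : cyl_measurable Z (gpast k) (coef k i j).
  apply: cyl_measurable_coef; [exact: subsetUl|by right; exists i|by right; exists j|].
  exact: cyl_measurable_state.
have mac c j : cyl_measurable Z (gpast k) (fun w => c * coef k i j w).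
  by apply: measurable_funM => //; exact: mc.
case: t => [[j|j]|j]; rewrite /term_coef; last exact: measurable_cst.
- by case: (E k i j); [exact: (mac a j)|exact: measurable_cst].
- by case: (E k i j); [exact: (mac b j)|exact: measurable_cst].
Qed.

Definition linform (im : bool) (a b : R) k i (w : T) : R :=
  \sum_t term_coef a b k i t w * Z (term_idx im k i t) w.

Definition weight i j : R := rho * (p i * (1 - p j) + p j * (1 - p i)) * Lam i j.

Notation ab := (abar E rho p Lam).

Definition residual k w : R :=
  \sum_i \sum_j ab k i j * (x k i w - pos (x k j w)) ^+ 2.

Definition increment k i w : R :=
  if failed k i then 0
  else yr k i w ^+ 2 + yi k i w ^+ 2 - s2 i - (\sum_j ab k i j) * x k i w.

Definition drift k i w : R := \sum_j ab k i j * (pos (x k j w) - x k i w).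

(** A martingale difference: [drift] is the conditional mean of [increment] given the past. *)
Definition noise k i w : R := increment k i w - drift k i w.

Definition second_moment k : R := \sum_j \int[P]_w (x k j w ^+ 2).

Lemma weight_gt0 i j : 0 < weight i j.
Proof.
rewrite /weight !mulr_gt0//.
by have /andP[? ?] := p01 i; have /andP[? ?] := p01 j; rewrite addr_gt0// mulr_gt0// subr_gt0.
Qed.

Lemma abarE k i j : ab k i j = if E k i j then weight i j else 0.
Proof. by []. Qed.

Lemma abar_ge0 k i j : 0 <= ab k i j.
Proof. by rewrite abarE; case: ifP => // _; rewrite ltW// weight_gt0. Qed.

Lemma abarC k i j : ab k i j = ab k j i.
Proof.
by rewrite !abarE EC; case: ifP => // _; rewrite /weight LamC [X in _ * X * _]addrC.
Qed.

Lemma abar_failed k i j : failed k i -> ab k i j = 0.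
Proof. by move=> fi; rewrite abarE (negbTE (Efail j fi)). Qed.

Lemma stateS k i w : x k.+1 i w = x k i w + alpha k * increment k i w.
Proof.
rewrite /= /increment; case: ifP => _; first by rewrite mulr0 addr0.
by ring.
Qed.

Lemma cyl_measurable_drift k i : cyl_measurable Z (past k) (drift k i).
Proof.
apply: measurable_sum => j; apply: measurable_funM => //; apply: measurable_funB.
  by apply: cyl_measurable_pos; exact: cyl_measurable_state.
exact: cyl_measurable_state.
Qed.

Lemma ler_sum1 (K : finType) (F : K -> R) t : (forall s, 0 <= F s) -> F t <= \sum_s F s.
Proof. by move=> F0; rewrite (bigD1 t)//= lerDl sumr_ge0. Qed.

Definition var_bound : R := \sum_i \sum_j Lam i j + \sum_i s2 i.

Lemma var_bound_ge0 : 0 <= var_bound.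
Proof.
by rewrite addr_ge0// sumr_ge0// => i _; rewrite sumr_ge0// => j _; rewrite ltW.
Qed.

Lemma s2_le_bound i : s2 i <= var_bound.
Proof.
apply: le_trans (ler_sum1 i s20) _; rewrite lerDr.
by rewrite sumr_ge0// => j _; rewrite sumr_ge0// => l _; rewrite ltW.
Qed.

Lemma Lam_le_bound i j : Lam i j <= var_bound.
Proof.
have L0 l m : 0 <= Lam l m by rewrite ltW.
apply: le_trans (ler_sum1 j (L0 i)) _.
have S0 l : 0 <= \sum_m Lam l m by rewrite sumr_ge0.
by apply: le_trans (ler_sum1 i S0) _; rewrite lerDl sumr_ge0.
Qed.

Lemma term_var_le i t : term_var i t <= var_bound.
Proof.
have h (v : R) : 0 <= v -> v <= var_bound -> v / 2 <= var_bound by move=> *; lra.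
case: t => [[j|j]|j] /=; apply: h; rewrite ?s2_le_bound ?Lam_le_bound ?s20 ?ltW//.
Qed.

Definition weight_bound : R := \sum_i \sum_j weight i j.

Lemma abar_row_le k i : 0 <= \sum_j ab k i j <= weight_bound.
Proof.
rewrite sumr_ge0 => [/=|j _]; last exact: abar_ge0.
have w0 l m : 0 <= weight l m by rewrite ltW// weight_gt0.
apply: (@le_trans _ _ (\sum_j weight i j)).
  by apply: ler_sum => j _; rewrite abarE; case: ifP.
by apply: (ler_sum1 (F := fun l => \sum_j weight l j)) => l; rewrite sumr_ge0.
Qed.

(** * Moment estimates for one step *)

Section step.
Variable k : nat.
Hypothesis Lx : forall j, sqintg P (x k j).

Lemma norm_pos_le (r : R) : `|pos r| <= `|r|.
Proof. by rewrite ger0_norm ?ge_max ?ler_norm ?normr_ge0// le_max lexx orbT. Qed.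

Lemma sqintg_pos j : sqintg P (fun w => pos (x k j w)).
Proof.
apply: le_sqintg (Lx j) => [|w]; last exact: norm_pos_le.
by apply: measurable_maxr => //; exact: measurable_state.
Qed.

Lemma second_moment_ge0 : 0 <= second_moment k.
Proof.
by apply: sumr_ge0 => j _; apply: Rintegral_ge0 => w _; exact: sqr_ge0.
Qed.

Lemma second_moment_ge j : \int[P]_w (x k j w ^+ 2) <= second_moment k.
Proof.
apply: (ler_sum1 (F := fun j => \int[P]_w (x k j w ^+ 2))) => l.
by apply: Rintegral_ge0 => w _; exact: sqr_ge0.
Qed.

Section linform.
Variables (a b : R) (i : 'I_N).
Hypotheses (a1 : a ^+ 2 <= 1) (b1 : b ^+ 2 <= 1).

Let term_coef_sqr_le t w : term_coef a b k i t w ^+ 2 <=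
  match t with inl (inl j) => rho * `|x k j w| | inl (inr j) => rho * `|x k j w| | inr _ => 1 end.
Proof.
have h (c : R) j : c ^+ 2 <= 1 ->
    (if E k i j then c * coef k i j w else 0) ^+ 2 <= rho * `|x k j w|.
  move=> c1; case: (E k i j); last by rewrite expr0n mulr_ge0// ltW.
  rewrite exprMn; apply: le_trans (sqr_coef_le k i j w).
  by rewrite ler_piMl// sqr_ge0.
by case: t => [[j|j]|j] /=; [exact: h|exact: h|rewrite expr1n].
Qed.

Lemma sqintg_term_coef t : sqintg P (fun w => term_coef a b k i t w ^+ 2).
Proof.
have mt : measurable_fun setT (fun w => term_coef a b k i t w ^+ 2).
  by apply: measurable_funX; exact: (cyl_measurableW mZ (@cyl_measurable_term_coef a b k i t)).
have h j : (forall w, term_coef a b k i t w ^+ 2 <= rho * `|x k j w|) ->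
    sqintg P (fun w => term_coef a b k i t w ^+ 2).
  move=> tx; apply: le_sqintg (sqintgZ rho (Lx j)) => // w.
  by rewrite ger0_norm ?sqr_ge0// normrM (ger0_norm (ltW rho0)).
case: t h mt => [[j|j]|j] h mt.
- by apply: (h j) => w; exact: (term_coef_sqr_le (inl (inl j))).
- by apply: (h j) => w; exact: (term_coef_sqr_le (inl (inr j))).
- by apply: le_sqintg (sqintg_cst P 1) => // w; rewrite /= expr1n.
Qed.

Lemma term_coef_moment4 t :
  \int[P]_w (term_coef a b k i t w ^+ 4) <= 1 + rho ^+ 2 * second_moment k.
Proof.
have I4 : intg P (fun w => term_coef a b k i t w ^+ 4).
  by under eq_fun do rewrite (exprM _ 2 2); exact: (sqintg_term_coef t).2.
have h j : (forall w, term_coef a b k i t w ^+ 2 <= rho * `|x k j w|) ->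
    \int[P]_w (term_coef a b k i t w ^+ 4) <= 1 + rho ^+ 2 * second_moment k.
  move=> tx; apply: (@le_trans _ _ (\int[P]_w (rho ^+ 2 * x k j w ^+ 2))).
    apply: le_Rintegral => //; first by apply: intgZ; exact: (Lx j).2.
    move=> w _; rewrite (exprM _ 2 2) -(real_normK (num_real (x k j w))) -exprMn.
    by rewrite ler_sqr ?nnegrE ?sqr_ge0 ?mulr_ge0 ?(ltW rho0).
  rewrite RintegralZl//; last exact: (Lx j).2.
  by rewrite ler_wpDl// ler_wpM2l ?sqr_ge0// second_moment_ge.
case: t h I4 => [[j|j]|j] h I4.
- by apply: (h j) => w; exact: (term_coef_sqr_le (inl (inl j))).
- by apply: (h j) => w; exact: (term_coef_sqr_le (inl (inr j))).
- under eq_Rintegral do rewrite /= expr1n.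
  by rewrite Rintegral1 lerDl mulr_ge0 ?sqr_ge0// second_moment_ge0.
Qed.

Let form im := @sqintg_sqr_linear_form _ _ _ P _ Z mZ indepZ (gpast k) term
  (term_idx im k i) (term_coef a b k i) (@term_idx_fresh im k i)
  (@cyl_measurable_term_coef a b k i) sqintg_term_coef.

Let sqintg_term_idx im t : sqintg P (fun w => Z (term_idx im k i t) w ^+ 2).
Proof. by have [] := term_moments im k i t. Qed.

Lemma sqintg_linform im : sqintg P (fun w => linform im a b k i w ^+ 2).
Proof.
exact: (@form im (sqintg_term_idx im)).1.
Qed.

(** [#|term| ^+ 3] comes from the power-mean inequality, the next [#|term|] counts the summands,
    [3 * var_bound ^+ 2] bounds a Gaussian fourth moment, and [1 + rho ^+ 2] absorbs
    [1 + rho ^+ 2 * second_moment k] into a multiple of [1 + second_moment k]. *)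
Definition linform_const : R :=
  #|term|%:R ^+ 3 * (#|term|%:R * ((1 + rho ^+ 2) * (3 * var_bound ^+ 2))).

Lemma linform_moment4 im :
  \int[P]_w (linform im a b k i w ^+ 4) <= linform_const * (1 + second_moment k).
Proof.
apply: le_trans (@form im (sqintg_term_idx im)).2 _.
rewrite /linform_const -(mulrA (_ ^+ 3)) ler_wpM2l ?exprn_ge0//.
apply: (@le_trans _ _ (\sum_(t : term) (1 + rho ^+ 2) * (3 * var_bound ^+ 2) * (1 + second_moment k))); last first.
  by rewrite sumr_const -[leLHS]mulr_natl mulrA.
apply: ler_sum => t _; have [_ _ _ ->] := term_moments im k i t.
have t2 : term_var i t ^+ 2 <= var_bound ^+ 2.
  by rewrite ler_sqr ?nnegrE ?term_var_ge0 ?var_bound_ge0// term_var_le.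
have c4 := term_coef_moment4 t.
have c0 : 0 <= \int[P]_w (term_coef a b k i t w ^+ 4).
  by apply: Rintegral_ge0 => w _; rewrite (exprM _ 2 2) sqr_ge0.
apply: (@le_trans _ _ ((1 + rho ^+ 2 * second_moment k) * (3 * var_bound ^+ 2))).
  apply: ler_pM => //; last by rewrite ler_pM2l.
  by rewrite mulr_ge0 ?sqr_ge0.
have s0 := second_moment_ge0.
rewrite [leRHS]mulrAC.
rewrite ler_wpM2r ?mulr_ge0 ?var_bound_ge0//.
have r0 := sqr_ge0 rho; move: s0 r0; move: (rho ^+ 2) (second_moment k) => r s s0 r0.
by nra.
Qed.

(** For the real and for the imaginary part [a ^+ 2 + b ^+ 2 = 1], so each contributes one half of
    the mean received power. *)
Lemma integral_linform im (G : T -> R) : cyl_measurable Z (past k) G -> sqintg P G ->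
  \int[P]_w (G w * linform im a b k i w ^+ 2) =
  (a ^+ 2 + b ^+ 2) / 2 * (\sum_j ab k i j * \int[P]_w (G w * pos (x k j w))) +
  s2 i / 2 * \int[P]_w G w.
Proof.
move=> mG LG.
have mG' : cyl_measurable Z (gpast k) G by apply: (cyl_measurableS _ mG); exact: subsetUl.
have Z0 t : \int[P]_w Z (term_idx im k i t) w = 0 by have [] := term_moments im k i t.
have Z2 t : \int[P]_w (Z (term_idx im k i t) w ^+ 2) = term_var i t.
  by have [] := term_moments im k i t.
rewrite (@integral_sqr_linear_form _ _ _ P _ Z mZ indepZ (gpast k) term
  (term_idx im k i) (term_coef a b k i) (@term_idx_inj im k i) (@term_idx_fresh im k i)
  (@cyl_measurable_term_coef a b k i) sqintg_term_coef (sqintg_term_idx im) G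
  (term_var i) mG' LG Z0 Z2).
rewrite !big_sumType big_ord1 /=; congr (_ + _); last first.
  by congr (_ * _); apply: eq_Rintegral => w _; rewrite expr1n mulr1.
have h (c : R) j : Lam i j / 2 * \int[P]_w (G w * (if E k i j then c * coef k i j w else 0) ^+ 2)
    = c ^+ 2 / 2 * (ab k i j * \int[P]_w (G w * pos (x k j w))).
  rewrite abarE; case: ifP => Eij; last first.
    under eq_Rintegral do rewrite expr0n mulr0.
    by rewrite Rintegral1; ring.
  have ij : i != j by apply: contraTneq Eij => ->; exact: Eirr.
  have IGx : intg P (fun w => G w * pos (x k j w)) by apply: sqintgM => //; exact: sqintg_pos.
  have mGx : cyl_measurable Z (past k) (fun w => (c ^+ 2 * rho) * (G w * pos (x k j w))).
    apply: measurable_funM => //; apply: measurable_funM; first exact: mG.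
    by apply: cyl_measurable_pos; exact: cyl_measurable_state.
  rewrite (@eq_Rintegral _ _ _ P setT (fun w => (c ^+ 2 * rho) * (G w * pos (x k j w)) * Gamma gam i j k w ^+ 2)).
    rewrite (integral_Gamma_sqr ij mGx); last exact: intgZ.
    by rewrite RintegralZl// /weight; ring.
  by move=> w _; rewrite exprMn sqr_coef; ring.
under eq_bigr do rewrite h.
under [X in _ + X]eq_bigr do rewrite h.
by rewrite -!mulr_sumr -mulrDl -mulrDl.
Qed.

End linform.

Let ure1 : ure ^+ 2 <= 1. Proof. by rewrite -u1 lerDl sqr_ge0. Qed.
Let uim1 : uim ^+ 2 <= 1. Proof. by rewrite -u1 lerDr sqr_ge0. Qed.
Let uimN1 : (- uim) ^+ 2 <= 1. Proof. by rewrite sqrrN. Qed.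

Lemma sqintg_increment i : sqintg P (increment k i).
Proof.
rewrite /increment; case: (failed k i); first exact: (sqintg_cst P 0).
apply: sqintgB; last exact: sqintgZ.
apply: sqintgB; last exact: (sqintg_cst P (s2 i)).
under eq_fun do rewrite y_reE y_imE.
by apply: sqintgD; exact: sqintg_linform.
Qed.

Lemma sqintg_drift i : sqintg P (drift k i).
Proof.
apply: sqintg_sum => j _; apply: sqintgZ; apply: sqintgB => //; exact: sqintg_pos.
Qed.

Lemma sqintg_noise i : sqintg P (noise k i).
Proof. by apply: sqintgB; [exact: sqintg_increment|exact: sqintg_drift]. Qed.

(** The mean received power is [s2 i] plus the weighted sum of the [x_j^+], and the update subtracts
    exactly what turns it into [drift]. A failed agent has no edges, so its drift vanishes together
    with its increment. *)
Lemma noise_centered i (G : T -> R) : cyl_measurable Z (past k) G -> sqintg P G ->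
  \int[P]_w (G w * noise k i w) = 0.
Proof.
move=> mG LG; rewrite /noise /increment.
have [fi|_] := boolP (failed k i).
  rewrite -[RHS](Rintegral1 P 0); apply: eq_Rintegral => w _.
  by rewrite /drift big1 ?subr0 ?mulr0// => j _; rewrite (abar_failed _ fi) mul0r.
have E1 w : G w * (yr k i w ^+ 2 + yi k i w ^+ 2 - s2 i - (\sum_j ab k i j) * x k i w - drift k i w) =
   G w * linform false ure (- uim) k i w ^+ 2 + G w * linform true uim ure k i w ^+ 2
   - (s2 i * G w + \sum_j ab k i j * (G w * pos (x k j w))).
  have -> : drift k i w = \sum_j ab k i j * pos (x k j w) - (\sum_j ab k i j) * x k i w.
    by rewrite mulr_suml -sumrB; apply: eq_bigr => j _; rewrite mulrBr.
  have -> : \sum_j ab k i j * (G w * pos (x k j w)) = G w * \sum_j ab k i j * pos (x k j w).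
    by rewrite mulr_sumr; apply: eq_bigr => j _; ring.
  by rewrite y_reE y_imE -/(linform false ure (- uim) k i w) -/(linform true uim ure k i w); ring.
under eq_Rintegral do rewrite E1.
have I1 := sqintgM LG (sqintg_linform i ure1 uimN1 false).
have I2 := sqintgM LG (sqintg_linform i uim1 ure1 true).
have I3 : intg P (fun w => s2 i * G w) by apply: intgZ; exact: sqintg_intg.
have I4 j : intg P (fun w => ab k i j * (G w * pos (x k j w))).
  by apply: intgZ; apply: sqintgM => //; exact: sqintg_pos.
have I5 : intg P (fun w => \sum_j ab k i j * (G w * pos (x k j w))) by apply: intg_sum.
rewrite RintegralB//; [|exact: intgD|exact: intgD].
rewrite !RintegralD// !integral_linform// RintegralZl//; last exact: sqintg_intg.
have -> : \int[P]_w (\sum_j ab k i j * (G w * pos (x k j w))) =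
    \sum_j ab k i j * \int[P]_w (G w * pos (x k j w)).
  rewrite Rintegral_sum//; apply: eq_bigr => j _.
  by rewrite RintegralZl//; apply: sqintgM => //; exact: sqintg_pos.
rewrite sqrrN [uim ^+ 2 + _]addrC u1; move: (\sum__ _) (\int[P]_w G w) => A B.
by field.
Qed.

(** The factor 4 comes from squaring a sum of four terms: two squared linear forms, the variance
    [s2 i] and the weighted state. *)
Definition increment_const : R :=
  4 * (2 * linform_const + var_bound ^+ 2 + weight_bound ^+ 2).

Lemma linform_const_ge0 : 0 <= linform_const.
Proof.
apply: mulr_ge0; first exact: exprn_ge0.
apply: mulr_ge0 => //; apply: mulr_ge0; first by rewrite addr_ge0 ?sqr_ge0.
by rewrite mulr_ge0 ?sqr_ge0.
Qed.

Lemma increment_const_ge0 : 0 <= increment_const.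
Proof.
apply: mulr_ge0 => //; apply: addr_ge0; last exact: sqr_ge0.
apply: addr_ge0; last exact: sqr_ge0.
by apply: mulr_ge0 => //; exact: linform_const_ge0.
Qed.

Lemma increment_moment2 i :
  \int[P]_w (increment k i w ^+ 2) <= increment_const * (1 + second_moment k).
Proof.
have s0 := second_moment_ge0.
have [fi|nf] := boolP (failed k i).
  under eq_Rintegral do rewrite /increment fi expr0n.
  by rewrite Rintegral1 mulr_ge0 ?increment_const_ge0// addr_ge0.
pose F1 := linform false ure (- uim) k i; pose F2 := linform true uim ure k i.
pose A := \sum_j ab k i j.
have I4 F : sqintg P (fun w => F w ^+ 2) -> intg P (fun w => F w ^+ 4).
  by move=> [_]; under eq_fun do rewrite -exprM.
have J1 : intg P (fun w => F1 w ^+ 4) by apply: I4; exact: sqintg_linform.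
have J2 : intg P (fun w => F2 w ^+ 4) by apply: I4; exact: sqintg_linform.
have J3 := (Lx i).2.
have J12 : intg P (fun w => F1 w ^+ 4 + F2 w ^+ 4) by exact: intgD.
have J123 : intg P (fun w => F1 w ^+ 4 + F2 w ^+ 4 + s2 i ^+ 2) by apply: intgD => //; exact: intg_cst.
have J1234 : intg P (fun w => F1 w ^+ 4 + F2 w ^+ 4 + s2 i ^+ 2 + A ^+ 2 * x k i w ^+ 2).
  by apply: intgD => //; exact: intgZ.
apply: (@le_trans _ _ (\int[P]_w (4 * (F1 w ^+ 4 + F2 w ^+ 4 + s2 i ^+ 2 + A ^+ 2 * x k i w ^+ 2)))).
  apply: le_Rintegral => //; [exact: (sqintg_increment i).2|exact: intgZ|move=> w _].
  rewrite /increment (negbTE nf) y_reE y_imE -/(F1 w) -/(F2 w) -/A.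
  rewrite (exprM (F1 w) 2 2) (exprM (F2 w) 2 2) -exprMn.
  move: (F1 w ^+ 2) (F2 w ^+ 2) (s2 i) (A * x k i w) => y z s t.
  have := sqr_ge0 (y - z); have := sqr_ge0 (y + s); have := sqr_ge0 (y + t).
  have := sqr_ge0 (z + s); have := sqr_ge0 (z + t); have := sqr_ge0 (s - t).
  by nra.
rewrite RintegralZl// /increment_const -mulrA ler_wpM2l//.
rewrite RintegralD//; last exact: intgZ.
rewrite RintegralD//; last exact: (intg_cst P (s2 i ^+ 2)).
rewrite RintegralD// Rintegral1 RintegralZl//.
have m1 := linform_moment4 i ure1 uimN1 false; have m2 := linform_moment4 i uim1 ure1 true.
have m3 := second_moment_ge i.
have /andP[A0 A1] := abar_row_le k i.
have A2 : A ^+ 2 <= weight_bound ^+ 2 by rewrite ler_sqr ?nnegrE// (le_trans A0).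
have S2 : s2 i ^+ 2 <= var_bound ^+ 2.
  by rewrite ler_sqr ?nnegrE ?s2_le_bound ?var_bound_ge0.
have A3 : A ^+ 2 * \int[P]_w (x k i w ^+ 2) <= weight_bound ^+ 2 * (1 + second_moment k).
  rewrite ler_pM ?sqr_ge0//; first by apply: Rintegral_ge0 => w _; exact: sqr_ge0.
  by rewrite (le_trans m3)// lerDr.
have S3 : s2 i ^+ 2 <= var_bound ^+ 2 * (1 + second_moment k).
  by rewrite (le_trans S2)// ler_peMr ?sqr_ge0// lerDl.
rewrite [leRHS](_ : _ = linform_const * (1 + second_moment k) +
  linform_const * (1 + second_moment k) + var_bound ^+ 2 * (1 + second_moment k) +
  weight_bound ^+ 2 * (1 + second_moment k)); last by ring.
by rewrite !lerD.
Qed.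

(** Pythagoras: [drift] depends on the past only, hence is orthogonal to [noise]. *)
Lemma noise_moment2 i :
  \int[P]_w (noise k i w ^+ 2) <= increment_const * (1 + second_moment k).
Proof.
apply: le_trans (increment_moment2 i).
have Ln := sqintg_noise i; have Ld := sqintg_drift i.
have E1 w : increment k i w ^+ 2 = drift k i w ^+ 2 + 2 * (drift k i w * noise k i w) + noise k i w ^+ 2.
  by rewrite /noise; ring.
under [leRHS]eq_Rintegral do rewrite E1.
have I1 := Ld.2; have I3 := Ln.2; have I2 := sqintgM Ld Ln.
rewrite RintegralD//; last by apply: intgD => //; exact: intgZ.
rewrite RintegralD//; last exact: intgZ.
rewrite RintegralZl// noise_centered ?mulr0 ?addr0//; last exact: cyl_measurable_drift.
by rewrite lerDr; apply: Rintegral_ge0 => w _; exact: sqr_ge0.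
Qed.

Lemma intg_residual : intg P (residual k).
Proof.
apply: intg_sum => i _; apply: intg_sum => j _; apply: intgZ.
by apply: (sqintgB (Lx i) (sqintg_pos j)).2.
Qed.

Lemma sqintg_stateS j : sqintg P (x k.+1 j).
Proof.
rewrite (_ : x k.+1 j = fun w => x k j w + alpha k * increment k j w); last first.
  by apply/funext => w; exact: stateS.
by apply: sqintgD => //; apply: sqintgZ; exact: sqintg_increment.
Qed.

(** The case [c = 0] of the Lyapunov inequality in expectation; the cross term with [noise] vanishes
    when tested against the state. *)
Lemma second_moment_step : 0 < alpha k ->
  second_moment k.+1 + alpha k * \int[P]_w residual k w <=
  second_moment k + N%:R * increment_const * alpha k ^+ 2 * (1 + second_moment k).
Proof.
move=> al0.
have step i : \int[P]_w (x k.+1 i w ^+ 2) = \int[P]_w (x k i w ^+ 2) +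
   2 * alpha k * \int[P]_w (x k i w * drift k i w) + alpha k ^+ 2 * \int[P]_w (increment k i w ^+ 2).
  have E1 w : x k.+1 i w ^+ 2 = x k i w ^+ 2 + (2 * alpha k) * (x k i w * drift k i w)
     + (2 * alpha k) * (x k i w * noise k i w) + alpha k ^+ 2 * increment k i w ^+ 2.
    by rewrite stateS /noise; ring.
  under eq_Rintegral do rewrite E1.
  have I1 := (Lx i).2; have I4 := (sqintg_increment i).2.
  have I2 := sqintgM (Lx i) (sqintg_drift i); have I3 := sqintgM (Lx i) (sqintg_noise i).
  have I12 := intgD I1 (intgZ (2 * alpha k) I2).
  have I123 := intgD I12 (intgZ (2 * alpha k) I3).
  rewrite RintegralD//; last exact: intgZ.
  rewrite RintegralD//; last exact: intgZ.
  rewrite RintegralD//; last exact: intgZ.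
  rewrite !RintegralZl// noise_centered ?mulr0 ?addr0//; exact: cyl_measurable_state.
rewrite /second_moment (eq_bigr _ (fun i _ => step i)) !big_split /=.
rewrite -/(second_moment k) -!mulr_sumr.
have D : 2 * \sum_i \int[P]_w (x k i w * drift k i w) <= - \int[P]_w residual k w.
  have Ixd i : intg P (fun w => x k i w * drift k i w) := sqintgM (Lx i) (sqintg_drift i).
  rewrite -Rintegral_sum// -RintegralZl//; last exact: intg_sum.
  rewrite -[leRHS]mulN1r -RintegralZl//; last exact: intg_residual.
  apply: le_Rintegral => //; [apply: intgZ; exact: intg_sum|apply: intgZ; exact: intg_residual|].
  move=> w _; rewrite mulN1r.
  have := drift_le (fun i => x k i w) (lexx 0) (@abar_ge0 k) (@abarC k).
  by under eq_bigr do rewrite subr0.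
have U : \sum_i \int[P]_w (increment k i w ^+ 2) <= N%:R * (increment_const * (1 + second_moment k)).
  apply: (@le_trans _ _ (\sum_(i < N) increment_const * (1 + second_moment k))).
    by apply: ler_sum => i _; exact: increment_moment2.
  by rewrite sumr_const card_ord mulr_natl.
have aU : alpha k ^+ 2 * \sum_i \int[P]_w (increment k i w ^+ 2) <=
   N%:R * increment_const * alpha k ^+ 2 * (1 + second_moment k).
  rewrite [leRHS](_ : _ = alpha k ^+ 2 * (N%:R * (increment_const * (1 + second_moment k)))); last by ring.
  by rewrite ler_wpM2l ?sqr_ge0.
have aD : 2 * alpha k * \sum_i \int[P]_w (x k i w * drift k i w) <=
    - (alpha k * \int[P]_w residual k w).
  by rewrite [2 * alpha k]mulrC -mulrA -mulrN ler_pM2l.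
by move: aU aD; lra.
Qed.

End step.

Lemma sqintg_state k i : sqintg P (x k i).
Proof.
elim: k i => [|k IH] i; first exact: (sqintg_cst P (x0 i)).
exact: sqintg_stateS.
Qed.

(** * Almost sure convergence of the Lyapunov functions *)

Hypothesis alpha0 : forall k, 0 < alpha k.
Hypothesis alpha2 : cvgn (series (fun k => alpha k ^+ 2)).

Lemma moments_bounded : exists M, forall n, second_moment n <= M /\
  \sum_(k < n) alpha k * \int[P]_w residual k w <= M.
Proof.
apply: (@discrete_gronwall _ second_moment (fun k => alpha k * \int[P]_w residual k w)
  (fun k => alpha k ^+ 2) (N%:R * increment_const)) => //.
- by rewrite mulr_ge0// increment_const_ge0.
- exact: second_moment_ge0.
- move=> k; rewrite mulr_ge0 ?(ltW (alpha0 k))//; apply: Rintegral_ge0 => w _.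
  by apply: sumr_ge0 => i _; apply: sumr_ge0 => j _; rewrite mulr_ge0 ?abar_ge0 ?sqr_ge0.
- by move=> k; exact: sqr_ge0.
- by move=> k; apply: second_moment_step => // j; exact: sqintg_state.
Qed.

Lemma residual_ge0 k w : 0 <= residual k w.
Proof.
by apply: sumr_ge0 => i _; apply: sumr_ge0 => j _; rewrite mulr_ge0 ?abar_ge0 ?sqr_ge0.
Qed.

Lemma ae_residual :
  {ae P, forall w, cvgn (series (fun k => alpha k * residual k w))}.
Proof.
have [M HM] := moments_bounded.
have Ir k : intg P (residual k) by apply: intg_residual => j; exact: sqintg_state.
apply: (@ae_cvgn_series_ge0 _ _ _ P (fun k w => alpha k * residual k w) M).
- by move=> k w; rewrite mulr_ge0 ?residual_ge0// ltW.
- by move=> k; exact: intgZ.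
- move=> n; apply: le_trans (HM n).2.
  by apply: ler_sum => k _; rewrite RintegralZl//; exact: Ir.
Qed.

Lemma sum_alpha2_le (C : R) n : 0 <= C ->
  \sum_(k < n) alpha k ^+ 2 * C <= limn (series (fun k => alpha k ^+ 2)) * C.
Proof.
move=> C0; rewrite -mulr_suml ler_wpM2r//.
have := series_le_limn n (fun k => sqr_ge0 (alpha k)) alpha2.
by rewrite /series/= big_mkord.
Qed.

Lemma ae_increment : {ae P, forall w,
  cvgn (series (fun k => \sum_i (alpha k * increment k i w) ^+ 2))}.
Proof.
have [M HM] := moments_bounded.
have Lx k j := sqintg_state k j.
have M0 : 0 <= M := le_trans (second_moment_ge0 0) (HM 0%N).1.
have CM0 : 0 <= N%:R * (increment_const * (1 + M)).
  by rewrite mulr_ge0// mulr_ge0 ?increment_const_ge0// addr_ge0.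
have I1 k i : intg P (fun w => (alpha k * increment k i w) ^+ 2).
  by apply: (sqintgZ (alpha k) (sqintg_increment (Lx k) i)).2.
apply: (@ae_cvgn_series_ge0 _ _ _ P
  (fun k w => \sum_i (alpha k * increment k i w) ^+ 2)
  (limn (series (fun k => alpha k ^+ 2)) * (N%:R * (increment_const * (1 + M))))).
- by move=> k w; apply: sumr_ge0 => i _; exact: sqr_ge0.
- by move=> k; exact: intg_sum.
- move=> n; apply: le_trans (sum_alpha2_le n CM0); apply: ler_sum => k _.
  rewrite Rintegral_sum//.
  apply: (@le_trans _ _ (\sum_(i < N) alpha k ^+ 2 * (increment_const * (1 + M)))); last first.
    by rewrite sumr_const card_ord -[leLHS]mulr_natl mulrCA.
  apply: ler_sum => i _; under eq_Rintegral do rewrite exprMn.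
  rewrite RintegralZl//; last exact: (sqintg_increment (Lx k) i).2.
  rewrite ler_wpM2l ?sqr_ge0//; apply: le_trans (increment_moment2 (Lx k) i) _.
  by rewrite ler_wpM2l ?increment_const_ge0// lerD2l (HM k).1.
Qed.

Lemma cyl_measurable_noise k i : cyl_measurable Z (past k.+1) (noise k i).
Proof.
have mp f : cyl_measurable Z (past k) f -> cyl_measurable Z (past k.+1) f.
  by apply: cyl_measurableS; exact: pastS.
apply: measurable_funB; last by apply: mp; exact: cyl_measurable_drift.
(* The increment is recovered from two consecutive states, whose adaptedness is known. *)
rewrite (_ : increment k i = fun w => (alpha k)^-1 * (x k.+1 i w - x k i w)).
  apply: measurable_funM => //; apply: measurable_funB.
    exact: cyl_measurable_state.
  by apply: mp; exact: cyl_measurable_state.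
by apply/funext => w; rewrite stateS addrAC subrr add0r mulKf// gt_eqF.
Qed.

(** A bounded predictable factor preserves the martingale property and keeps the variances below a
    constant times [alpha k ^+ 2]. *)
Lemma ae_noise (b : nat -> T -> R) i :
  (forall k, cyl_measurable Z (past k) (b k)) -> (forall k w, `|b k w| <= 1) ->
  {ae P, forall w, cvgn (series (fun k => alpha k * (b k w * noise k i w)))}.
Proof.
move=> mb b1.
have [M HM] := moments_bounded.
have M0 : 0 <= M := le_trans (second_moment_ge0 0) (HM 0%N).1.
have Lx k j := sqintg_state k j.
have Ln k : sqintg P (noise k i) := sqintg_noise (Lx k) i.
have mbT k : measurable_fun setT (b k) := cyl_measurableW mZ (mb k).
have Lbn k : sqintg P (fun w => b k w * noise k i w).
  apply: le_sqintg (Ln k); first by apply: measurable_funM; [exact: mbT|exact: (Ln k).1].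
  by move=> w; rewrite normrM ler_piMl.
have CM0 : 0 <= increment_const * (1 + M).
  by rewrite mulr_ge0 ?increment_const_ge0// addr_ge0.
apply: (@ae_cvgn_martingale_series _ _ _ P (fun k => cylinder Z (past k))
  (fun k w => alpha k * (b k w * noise k i w))).
- by move=> k; apply: cylinderS; exact: pastS.
- by move=> k; exact: sigma_cylinder_measurable.
- move=> k; apply: measurable_funM => //; apply: measurable_funM.
    by apply: (cyl_measurableS _ (mb k)); exact: pastS.
  exact: cyl_measurable_noise.
- by move=> k; exact: sqintgZ.
- move=> k U K mU UK.
  have mUb : cyl_measurable Z (past k) (fun w => alpha k * (U w * b k w)).
    by apply: measurable_funM => //; apply: measurable_funM; [exact: mU|exact: mb].
  rewrite -[RHS](noise_centered (Lx k) i mUb).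
    by apply: eq_Rintegral => w _; ring.
  apply: sqintgZ; apply: (le_sqintg _ _ (sqintg_cst P K)).
    by apply: measurable_funM; [exact: (cyl_measurableW mZ mU)|exact: mbT].
  move=> w; rewrite normrM (le_trans _ (ler_norm K))// (le_trans _ (UK w))//.
  by rewrite ler_piMr.
- apply: (@cvgn_series_ge0_le _ _ (limn (series (fun k => alpha k ^+ 2)) * (increment_const * (1 + M)))).
    by move=> k; apply: Rintegral_ge0 => w _; exact: sqr_ge0.
  move=> n; rewrite /series/= big_mkord; apply: le_trans (sum_alpha2_le n CM0).
  apply: ler_sum => k _; under eq_Rintegral do rewrite exprMn.
  rewrite RintegralZl//; last exact: (Lbn k).2.
  rewrite ler_wpM2l ?sqr_ge0//.
  apply: (@le_trans _ _ (\int[P]_w (noise k i w ^+ 2))).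
    apply: le_Rintegral => //; [exact: (Lbn k).2|exact: (Ln k).2|move=> w _].
    rewrite exprMn ler_piMl ?sqr_ge0// -real_normK ?num_real//.
    by rewrite expr_le1.
  apply: le_trans (noise_moment2 (Lx k) i) _.
  by rewrite ler_wpM2l ?increment_const_ge0// lerD2l (HM k).1.
Qed.

Definition lyapunov (c : R) k w : R := \sum_i (x k i w - c) ^+ 2.

(** The gradient of [sqrt (1 + V_c)]. The absolute value leaves it unchanged, as [V_c >= 0], and
    makes the normalizing factor a continuous function on the whole line. *)
Definition direction (c : R) i k w : R :=
  (x k i w - c) * (Num.sqrt (1 + `|lyapunov c k w|))^-1.

Lemma lyapunov_ge0 c k w : 0 <= lyapunov c k w.
Proof. by apply: sumr_ge0 => i _; exact: sqr_ge0. Qed.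

Lemma cyl_measurable_direction c i k : cyl_measurable Z (past k) (direction c i k).
Proof.
have mxc j : cyl_measurable Z (past k) (fun w => x k j w - c).
  by apply: measurable_funB => //; exact: cyl_measurable_state.
have mV : cyl_measurable Z (past k) (lyapunov c k).
  by apply: measurable_sum => j; apply: measurable_funX; exact: mxc.
have mh : measurable_fun [set: R] (fun v : R => (Num.sqrt (1 + `|v|))^-1).
  apply: continuous_measurable_fun => v; apply: cvgV.
    by rewrite gt_eqF// sqrtr_gt0 ltr_wpDr.
  apply: continuous_cvg; first exact: sqrt_continuous.
  by apply: cvgD; [exact: cvg_cst|apply: cvg_norm; exact: cvg_id].
by apply: measurable_funM; [exact: mxc|exact: (measurableT_comp mh mV)].
Qed.

Lemma direction_le1 c i k w : `|direction c i k w| <= 1.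
Proof.
have V0 := lyapunov_ge0 c k w.
have s0 : 0 < Num.sqrt (1 + `|lyapunov c k w|) by rewrite sqrtr_gt0 ltr_wpDr.
rewrite /direction normrM normfV (ger0_norm (ltW s0)) ler_pdivrMr// mul1r.
rewrite -sqrtr_sqr ler_sqrt ?addr_ge0// (ger0_norm V0).
apply: le_trans (_ : lyapunov c k w <= _); last by rewrite lerDr.
by apply: (ler_sum1 (F := fun i => (x k i w - c) ^+ 2)) => j; exact: sqr_ge0.
Qed.

Lemma ae_lyapunov c : 0 <= c -> {ae P, forall w, cvgn (fun k => lyapunov c k w)}.
Proof.
move=> c0.
have Hn : \forall w \ae P, forall i,
    cvgn (series (fun k => alpha k * (direction c i k w * noise k i w))).
  apply: filter_forall => i; apply: ae_noise => [k|k w].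
    exact: cyl_measurable_direction.
  exact: direction_le1.
move: Hn ae_increment; apply: filterS2 => w Hn Hi.
pose mu k := \sum_i alpha k * (direction c i k w * noise k i w).
apply: (@cvgn_sqrt_lyapunov _ _ mu (fun k => \sum_i (alpha k * increment k i w) ^+ 2)) => //.
- by move=> k; exact: lyapunov_ge0.
- by move=> k; apply: sumr_ge0 => i _; exact: sqr_ge0.
- move=> k.
  have V0 := lyapunov_ge0 c k w.
  have s0 : 0 < Num.sqrt (1 + lyapunov c k w) by rewrite sqrtr_gt0 ltr_wpDr.
  (* Multiplying by the square root undoes the normalization, so [mu] yields exactly the martingale
     term in the expansion of [V_c]. *)
  have Wmu : Num.sqrt (1 + lyapunov c k w) * mu k =
      alpha k * \sum_i (x k i w - c) * noise k i w.
    rewrite /mu !mulr_sumr; apply: eq_bigr => i _.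
    rewrite /direction (ger0_norm V0); move: s0; move: (Num.sqrt _) => s s0.
    by field; rewrite gt_eqF.
  have VS : lyapunov c k.+1 w = lyapunov c k w +
      alpha k * (2 * \sum_i (x k i w - c) * drift k i w) +
      2 * (alpha k * \sum_i (x k i w - c) * noise k i w) +
      \sum_i (alpha k * increment k i w) ^+ 2.
    rewrite /lyapunov !mulr_sumr -!big_split; apply: eq_bigr => i _.
    by rewrite stateS /noise /=; ring.
  rewrite VS Wmu -addrA -[leRHS]addrA lerD2r gerDl pmulr_rle0//.
  apply: le_trans (drift_le (fun i => x k i w) c0 (@abar_ge0 k) (@abarC k)) _.
  by rewrite oppr_le0 residual_ge0.
- rewrite (_ : series mu = \sum_i series (fun k => alpha k * (direction c i k w * noise k i w))).
    by elim/big_ind: _ => [|u v cu cv|i _]; [exact: is_cvg_cst|exact: is_cvgD|exact: Hn].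
  by apply/funext => n; rewrite fct_sumE /series/= exchange_big.
Qed.

Variable L : nat.
Hypothesis alpha_div : series alpha @ \oo --> +oo.
Hypothesis Econ : forall k, graph_connected (union_graph E k L).
Hypothesis alpha_decr : forall k, alpha k.+1 <= alpha k.

Lemma ae_consensus : {ae P, forall w,
  exists l : R, forall i, (fun k => x k i w) @ \oo --> l}.
Proof.
have [a0 a0_gt0 a0_le] := finite_pos_lower_bound
  (f := fun z : 'I_N * 'I_N => weight z.1 z.2) (fun z => weight_gt0 z.1 z.2).
have Hlyap : \forall w \ae P,
    cvgn (fun k => lyapunov 0 k w) /\ cvgn (fun k => lyapunov 1 k w).
  by move: (ae_lyapunov (lexx 0)) (ae_lyapunov ler01); apply: filterS2 => w; split.
move: ae_residual ae_increment Hlyap; apply: filterS3 => w Hres Hinc [H0 H1].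
have VS k c : lyapunov c k w = lyapunov 0 k w - 2 * c * \sum_i x k i w + N%:R * c ^+ 2.
  have -> : N%:R * c ^+ 2 = \sum_(i < N) c ^+ 2 by rewrite sumr_const card_ord mulr_natl.
  rewrite /lyapunov mulr_sumr -sumrB -big_split.
  by apply: eq_bigr => i _ /=; ring.
apply: (@consensus R N E L alpha (abar E rho p Lam) a0 (fun k i => x k i w)) => //.
- exact: abar_ge0.
- by move=> k i j Eij; rewrite abarE Eij; exact: (a0_le (i, j)).
- move=> i.
  rewrite (_ : (fun k => _) = (fun k => alpha k * increment k i w)); last first.
    by apply/funext => k; rewrite stateS addrAC subrr add0r.
  apply/norm_cvg0P.
  have s0 := cvg_series_cvg_0 Hinc.
  have ss0 : (fun k => Num.sqrt (\sum_i (alpha k * increment k i w) ^+ 2)) @ \oo --> (0 : R).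
    rewrite -[X in _ --> X](sqrtr0 R).
    by apply: continuous_cvg => //; exact: sqrt_continuous.
  apply: squeeze_cvgr ss0; last exact: cvg_cst.
  apply: nearW => k; rewrite normr_ge0/= -sqrtr_sqr.
  rewrite ler_sqrt; last by apply: sumr_ge0 => j _; exact: sqr_ge0.
  by apply: (ler_sum1 (F := fun j => (alpha k * increment k j w) ^+ 2)) => j; exact: sqr_ge0.
- rewrite (_ : (fun k => \sum_i x k i w) =
    (fun k => (lyapunov 0 k w - lyapunov 1 k w + N%:R) * 2^-1)).
    apply: is_cvgM; last exact: is_cvg_cst.
    by apply: is_cvgD; [exact: is_cvgB|exact: is_cvg_cst].
  by apply/funext => k; rewrite (VS k 1); field.
- rewrite (_ : (fun k => \sum_i x k i w ^+ 2) = (fun k => lyapunov 0 k w))//.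
  by apply/funext => k; apply: eq_bigr => i _; rewrite subr0.
Qed.

Lemma ae_consensus_measurable : exists xstar : T -> R, measurable_fun setT xstar /\
  forall i, {ae P, forall w, (fun k => x k i w) @ \oo --> xstar w}.
Proof.
have [N0|N0] := posnP N.
  by exists (cst 0); split => // -[i iN]; exfalso; move: iN; rewrite N0.
pose i0 := Ordinal N0.
(* The pathwise limits are given only almost everywhere; the upper limit of one fixed agent is
   measurable everywhere and agrees with them there, while [fine] supplies the value 0 where it is
   infinite. *)
exists (fun w => fine (limn_esup (fun k => (x k i0 w)%:E))); split.
  apply: measurableT_comp => //.
  by apply: measurable_fun_limn_esup => k; apply/measurable_EFinP; exact: measurable_state.
move=> i; apply: filterS ae_consensus => w [l Hl].
have lE : limn_esup (fun k => (x k i0 w)%:E) = l%:E.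
  by apply: (cvg_limn_einf_sup _).2; apply: cvg_EFin => //; [exact: nearW|exact: Hl].
by rewrite lE.
Qed.

End protocol.

Theorem theorem6 (R : realType) (d : measure_display) (T : measurableType d)
  (P : probability T R) (N : nat)
  (E : nat -> rel 'I_N) (failed : nat -> pred 'I_N)
  (x0 : 'I_N -> R) (xmax : R) (rho ure uim : R)
  (p : 'I_N -> R) (Lam : 'I_N -> 'I_N -> R) (s2 : 'I_N -> R)
  (alpha : nat -> R)
  (gam : 'I_N -> nat -> T -> R) (hre him : 'I_N -> 'I_N -> nat -> T -> R)
  (nre nim : 'I_N -> nat -> T -> R) (L : nat) :
  (* graph model *)
  (forall k i j, E k i j = E k j i) ->
  (forall k i, ~~ E k i i) ->
  (forall k i j, failed k i -> ~~ E k i j) ->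
  (* parameters *)
  (forall i, 0 <= x0 i <= xmax) ->
  0 < rho ->
  ure ^+ 2 + uim ^+ 2 = 1 ->
  (forall i, 0 < p i < 1) ->
  (forall i j, Lam i j = Lam j i) ->
  (forall i j, 0 < Lam i j) ->
  (forall i, 0 <= s2 i) ->
  (* random variables: measurability, laws, mutual independence *)
  (forall a, measurable_fun setT (all_rvs gam hre him nre nim a)) ->
  (forall i k w, gam i k w = 0 \/ gam i k w = 1) ->
  (forall i k, P (gam i k @^-1` [set 1]) = (p i)%:E) ->
  (forall i j k, complex_gaussian_parts P (hre i j k) (him i j k) (Lam i j)) ->
  (forall i k, complex_gaussian_parts P (nre i k) (nim i k) (s2 i)) ->
  mutually_independent P (all_rvs gam hre him nre nim) ->
  (* (i) step sizes *)
  (forall k, 0 < alpha k) ->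
  series alpha @ \oo --> +oo ->
  cvgn (series (fun k => alpha k ^+ 2)) ->
  (forall i k, 0 < 1 - alpha k * \sum_j abar E rho p Lam k i j) ->
  (* (ii) L-connectivity *)
  (0 < L)%N ->
  (forall k, graph_connected (union_graph E k L)) ->
  (* (iii) *)
  (forall k, alpha k.+1 <= alpha k) ->
  (limn_esup (fun k => (alpha k / alpha k.+1)%:E) < +oo)%E ->
  (* conclusion: almost sure consensus *)
  exists xstar : T -> R, measurable_fun setT xstar /\
    forall i : 'I_N, {ae P, forall w,
      (fun k => xstate E failed x0 alpha rho ure uim p Lam s2 gam hre him nre nim k i w)
        @ \oo --> xstar w}.
Proof.
move=> EC Eirr Efail _ rho0 u1 p01 LamC Lam0 s20 mZ gam01 Pgam gh gn indepZ
  alpha0 alpha_div alpha2 _ _ Econ alpha_decr _.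
exact: (@ae_consensus_measurable R d T P N E failed x0 rho ure uim p Lam s2 alpha
  gam hre him nre nim EC Eirr Efail rho0 u1 p01 LamC Lam0 s20 mZ gam01 Pgam gh gn
  indepZ alpha0 alpha2 L alpha_div Econ alpha_decr).
Qed.
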